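(* Let $\mathcal{R}$ be the set of all curves $\mathcal{C}\subset\mathbb{R}^2$ for which there exist an integer $n\ge3$, an integer $m\ge0$, $\rho>0$ and real coefficients such that $\mathcal{C}$ is parametrized by $\theta\in[-\pi,\pi]\mapsto\big(p(\theta)\cos\theta-p'(\theta)\sin\theta,\ p(\theta)\sin\theta+p'(\theta)\cos\theta\big)$ with $$p(\theta)=\rho+\sum_{k=0}^{m}\big(a_{kn+1}\cos(kn+1)\theta+b_{kn+1}\sin(kn+1)\theta+a_{kn-1}\cos(kn-1)\theta+b_{kn-1}\sin(kn-1)\theta\big)$$ and $p+p''\geq0$ on $\mathbb{R}$. Then the minimum, over all curves in $\mathcal{R}$ that are not circles, of the total degree of the defining polynomial of the curve equals $6$.
   Context: The defining polynomial of the curve $\mathcal{C}$ is the irreducible polynomial $f\in\mathbb{R}[x,y]$, unique up to a nonzero constant factor, whose zero set is the Zariski closure of $\mathcal{C}$. *)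

(* Defs.v *)
From Stdlib Require Import Reals ZArith.
From Coquelicot Require Import Coquelicot.
From mathcomp Require Import all_boot all_algebra.
From mathcomp Require Import Rstruct.
From mathcomp Require Import mpoly.

Set Implicit Arguments.
Unset Strict Implicit.
Unset Printing Implicit Defensive.

Definition poly2 := {mpoly R[2]}.

Definition ev2 (f : poly2) (x y : R) : R :=
  f.@[[ffun i : 'I_2 => if val i == 0%N then x else y]].

(* total degree (msize f = 1 + total degree for f <> 0) *)
Definition tdeg (f : poly2) : nat := (msize f).-1.

(* irreducible in R[x,y]: non-constant, and any factorisation has a
   constant (hence unit, since f <> 0) factor *)
Definition irreducible2 (f : poly2) : Prop :=
  (1 < msize f)%N /\
  forall g h : poly2, f = (g * h)%R -> (msize g <= 1)%N \/ (msize h <= 1)%N.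

Definition zariski_closure (C : R -> R -> Prop) (x y : R) : Prop :=
  forall g : poly2, (forall u v, C u v -> ev2 g u v = 0%R) -> ev2 g x y = 0%R.

(* f is the defining polynomial of C (unique up to a nonzero constant) *)
Definition defining_poly (f : poly2) (C : R -> R -> Prop) : Prop :=
  irreducible2 f /\ forall x y, ev2 f x y = 0%R <-> zariski_closure C x y.

Open Scope R_scope.

(* the support function
   p(t) = rho + sum_{k=0}^m ( a_{kn+1} cos((kn+1)t) + b_{kn+1} sin((kn+1)t)
                            + a_{kn-1} cos((kn-1)t) + b_{kn-1} sin((kn-1)t) )
   with coefficients indexed by integers (k = 0 gives the indices 1 and -1). *)
Definition supp_fun (n m : nat) (rho : R) (a b : Z -> R) (t : R) : R :=
  rho + sum_f_R0 (fun k =>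
      let jp := Z.add (Z.of_nat (k * n)) 1 in
      let jm := Z.sub (Z.of_nat (k * n)) 1 in
      a jp * cos (IZR jp * t) + b jp * sin (IZR jp * t)
    + a jm * cos (IZR jm * t) + b jm * sin (IZR jm * t)) m.

Definition curve_of (p : R -> R) (x y : R) : Prop :=
  exists t, -PI <= t <= PI /\
    x = p t * cos t - Derive p t * sin t /\
    y = p t * sin t + Derive p t * cos t.

Definition in_class_R (C : R -> R -> Prop) : Prop :=
  exists (n m : nat) (rho : R) (a b : Z -> R),
    (3 <= n)%nat /\ 0 < rho /\
    (forall t, 0 <= supp_fun n m rho a b t + Derive_n (supp_fun n m rho a b) 2 t) /\
    (forall x y, C x y <-> curve_of (supp_fun n m rho a b) x y).

Definition is_circle (C : R -> R -> Prop) : Prop :=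
  exists x0 y0 r, 0 < r /\
    forall x y, C x y <-> (x - x0) ^ 2 + (y - y0) ^ 2 = r ^ 2.

(* Main.v *)
(** Writing [z = x + i y] and [w = exp (i t)], a curve of the class with top
    frequency [J >= 2] satisfies [z ~ (1 - J) c w^(J+1)] and
    [conj z ~ (1 + J) c w^(J-1)] as [w -> oo], where [c != 0]. Let [f] be a real
    polynomial vanishing on the curve, expanded in the monomials
    [z^i (conj z)^k]. The monomials of top weight [(J+1) i + (J-1) k] must
    cancel, so there are two of them, and the one with the larger [k] has
    [k >= (J+1) / gcd (J+1, J-1)]; since [f] is real, its support is symmetric
    in [(i, k)], which forces [i >= k]. Hence [deg f = i + k >= 6] unless
    [J = 3]. In that case [n = 4], and [rho != 0] makes the next relevant
    coefficient of the expansion at infinity force two top monomials at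
    distance [4] in [k].

    The polynomials vanishing on the curve form a prime ideal, because the curve
    is parametrized by Laurent polynomials in [w]; it is nonzero by a dimension
    count. An element of least degree in [y], then of least degree of its leading
    coefficient, is irreducible and its zeros are common to the ideal.

    The value [6] is attained by [p = 3/2 + 1/2 cos 2t], which traces
    [x = 3 cos t - cos^3 t], [y = sin^3 t], the zero set of
    [(x^2 + y^2 - 4)^3 + 27 y^4]. *)

Require Import Defs.
From Stdlib Require Import Reals Lra Classical.
From Coquelicot Require Import Coquelicot.
From mathcomp Require Import all_boot all_algebra.
From mathcomp Require Import Rstruct.
From mathcomp Require Import mpoly.
From mathcomp Require Import complex zify ring.

Import GRing.Theory Num.Theory.

Set Implicit Arguments.
Unset Strict Implicit.
Unset Printing Implicit Defensive.

(* [%R] and [%Z] denote MathComp's scopes here *)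
Delimit Scope R_scope with coqR.
Delimit Scope Z_scope with coqZ.
Local Open Scope ring_scope.

(** * The Newton polygon at infinity *)

(** Infinitude as duplicate-free lists of every length, the form in which a bound on the number of
    roots applies. *)
Definition infinite_pred (T : eqType) (S : T -> Prop) :=
  forall N, exists s : seq T,
    [/\ uniq s, size s = N & forall v, v \in s -> S v].

Lemma infinite_roots_eq0 (K : idomainType) (S : K -> Prop) (p : {poly K}) :
  infinite_pred S -> (forall v, S v -> p.[v] = 0) -> p = 0.
Proof.
move=> infS p0; have [//|pn0] := eqVneq p 0.
have [s [us ss Ss]] := infS (size p).
have: (size s < size p)%N.
  apply: max_poly_roots => //; apply/allP => v /Ss /p0 pv; exact/rootP.
by rewrite ss ltnn.
Qed.

(** [J.+1] and [J.-1] are coprime for even [J]; [a] and [b] stand for the exponent differences of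
    two monomials of equal weight. *)
Lemma dvdn_edge_even J a b :
  (0 < J)%N -> ~~ odd J -> (J.+1 * a = J.-1 * b)%N -> (J.+1 %| b)%N.
Proof.
move=> J0 oJ e.
rewrite -(@Gauss_dvdr _ J.-1); first by rewrite -e dvdn_mulr.
have -> : J.+1 = (J.-1 + 2)%N by lia.
rewrite coprime_sym /coprime gcdnDl -/(coprime _ _) coprimen2; lia.
Qed.

(** For odd [J] the halves of [J.+1] and [J.-1] are consecutive integers, hence coprime. *)
Lemma dvdn_edge_odd J a b :
  odd J -> (J.+1 * a = J.-1 * b)%N -> (J.+1./2 %| b)%N.
Proof.
move=> oJ e; have [l Jl] : exists l, J = l.*2.+1 by exists J./2; lia.
have -> : J.+1./2 = l.+1 by lia.
rewrite -(@Gauss_dvdr _ l); last by rewrite coprimeSn.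
by have <- : (l.+1 * a = l * b)%N; [rewrite Jl in e; nia | rewrite dvdn_mulr].
Qed.

(** Equal weights give [b' - b = 2 (a - a')], while [b' <= a'] and [a' + b' < 6] give [b' <= 2]. *)
Lemma edge_gap_three a b a' b' : (4 * a + 2 * b = 4 * a' + 2 * b')%N ->
  (b < b')%N -> (b' <= a')%N -> (a' + b' < 6)%N ->
  (b' = b + 2)%N /\ (a = a' + 1)%N.
Proof. lia. Qed.

(** * Low coefficients of products and powers of polynomials without a linear term *)

Section CoefThree.
Variable K : comNzRingType.
Implicit Types P Q : {poly K}.

Lemma coef1M0 P Q : P`_1 = 0 -> Q`_1 = 0 -> (P * Q)`_1 = 0.
Proof.
by move=> p q; rewrite coefM !big_ord_recl big_ord0 /= p q mul0r mulr0 !addr0.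
Qed.

Lemma coef3M0 P Q : P`_1 = 0 -> Q`_1 = 0 ->
  (P * Q)`_3 = P`_0 * Q`_3 + P`_3 * Q`_0.
Proof.
move=> p q; rewrite coefM !big_ord_recl big_ord0 /= !subn0 /bump /=.
rewrite !(subSS, subn0, add1n) /= p q; ring.
Qed.

Lemma coef1X0 P n : P`_1 = 0 -> (P ^+ n)`_1 = 0.
Proof.
move=> p; elim: n => [|n ih]; first by rewrite expr0 coef1.
by rewrite exprS coef1M0.
Qed.

Lemma coef0X P n : (P ^+ n)`_0 = P`_0 ^+ n.
Proof. by rewrite -!horner_coef0 horner_exp. Qed.

(* the factor [P`_0] on the left avoids the exponent [n.-1] *)
Lemma coef3X0 P n : P`_1 = 0 ->
  P`_0 * (P ^+ n)`_3 = n%:R * P`_3 * P`_0 ^+ n.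
Proof.
move=> p; elim: n => [|n ih]; first by rewrite expr0 coef1 /=; ring.
rewrite exprS coef3M0 ?coef1X0 // mulrDr ih coef0X exprS -natr1; ring.
Qed.

End CoefThree.

(** * Cancellation among the monomials of highest pole order *)

Section NewtonEdge.
Variables (K : fieldType) (n : nat) (h : nat -> nat -> K) (J : nat).
Variables (A B : {poly K}) (S : K -> Prop).
Let I := ('I_n * 'I_n)%type.
(** The pole order at [v = 0] of the monomial with exponents [q] in [A.[v] / v ^+ J.+1] and [B.[v] /
    v ^+ J.-1], once [A] and [B] are nonzero at 0; [h] holds the coefficients of the monomials. *)
Let wt (q : I) := (J.+1 * q.1 + J.-1 * q.2)%N.
Let P (q : I) := h q.1 q.2 != 0.

Hypothesis infS : infinite_pred S.
Hypothesis S0 : forall v, S v -> v != 0.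
Hypothesis hS : forall v, S v ->
  \sum_(q : I) h q.1 q.2 * (A.[v] / v ^+ J.+1) ^+ q.1
                         * (B.[v] / v ^+ J.-1) ^+ q.2 = 0.
Hypothesis symP : forall q, P q -> P (q.2, q.1).
Variable q1 : I.
Hypothesis Pq1 : P q1.

Let q0 := [arg max_(q > q1 | P q) wt q].
Let M := wt q0.
Let Pq0 : P q0. Proof. by rewrite /q0; case: arg_maxnP. Qed.
Let maxM q : P q -> (wt q <= M)%N.
Proof. by rewrite /M /q0; case: arg_maxnP => // i _ m /m. Qed.

(** Multiplication by [v ^+ M], with [M] the largest weight in the support, clears the denominators
    and leaves a polynomial with infinitely many roots. *)
Lemma edge_poly_eq0 :
  \sum_(q | P q) h q.1 q.2 *: (A ^+ q.1 * B ^+ q.2 * 'X^(M - wt q)) = 0.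
Proof.
apply: (infinite_roots_eq0 infS) => v Sv; have v0 := S0 Sv.
rewrite horner_sum; have := congr1 (fun x => v ^+ M * x) (hS Sv).
rewrite mulr0 mulr_sumr => e; rewrite -[RHS]e {e}.
rewrite [RHS](bigID P) /= [X in _ + X]big1.
  rewrite addr0; apply: eq_bigr => q Pq.
  rewrite hornerZ !hornerM !horner_exp hornerX !expr_div_n -!exprM.
  have -> : v ^+ M = v ^+ (M - wt q) * (v ^+ (J.+1 * q.1) * v ^+ (J.-1 * q.2)).
    by rewrite -!exprD subnK // maxM.
  by field; rewrite !expf_neq0.
by move=> q; rewrite negbK => /eqP ->; rewrite !mul0r mulr0.
Qed.

Hypothesis A0 : A`_0 != 0.
Hypothesis B0 : B`_0 != 0.

Let term (q : I) := h q.1 q.2 * (A`_0 ^+ q.1 * B`_0 ^+ q.2).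

Lemma edge_sum_eq0 : \sum_(q | P q && (wt q == M)) term q = 0.
Proof.
have := congr1 (fun p : {poly K} => p`_0) edge_poly_eq0.
rewrite coef0 coef_sum (bigID (fun q => wt q == M)) /= [X in _ + X]big1.
  rewrite addr0 => e; rewrite -[RHS]e; apply: eq_bigr => q /andP[_ /eqP ->].
  by rewrite subnn expr0 mulr1 coefZ /term -!horner_coef0 hornerM !horner_exp.
move=> q /andP[Pq wq]; rewrite coefZ coefMXn ifT ?mulr0 //.
by have := maxM Pq; lia.
Qed.

(** A single top term would be nonzero and could not cancel; distinct monomials of equal weight
    differ in the second exponent, because [J.+1] is positive. *)
Lemma edge_pair : exists q q' : I,
  [/\ P q, P q', wt q = M, wt q' = M & (q.2 < q'.2)%N].
Proof.
suff [q' /and3P[Pq' /eqP wq' nq']] :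
    exists q', [&& P q', wt q' == M & q' != q0].
  have : q'.2 != q0.2 :> nat.
    apply: contraNneq nq' => e; apply/eqP; apply: injective_projections.
      apply: val_inj; move/eqP: wq'.
      by rewrite /M /wt e eqn_add2r eqn_pmul2l // => /eqP.
    exact: val_inj.
  rewrite neq_ltn => /orP[l|l]; first by exists q', q0.
  by exists q0, q'.
apply/existsP; apply: contraT; rewrite negb_exists => /forallP no.
have := edge_sum_eq0; rewrite (bigD1 q0) /=; last by rewrite Pq0 eqxx.
rewrite big1 ?addr0 => [/eqP|q /andP[/andP[Pq wq] nq]]; last first.
  by have := no q; rewrite Pq wq nq.
by rewrite /term !mulf_eq0 !expf_eq0 (negbTE A0) (negbTE B0) !andbF !orbF
   (negbTE (Pq0 : h _ _ != 0)).
Qed.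

(** The swapped monomial is in the support too, and its weight exceeds that of [q] by
    [2 (q.2 - q.1)], which maximality forbids to be positive. *)
Lemma top_degree_ge (q : I) : (0 < J)%N -> P q -> wt q = M -> (q.2 <= q.1)%N.
Proof. by move=> J0 Pq wq; have := maxM (symP Pq); rewrite -wq /wt /=; nia. Qed.

(** The larger second exponent is at least [J.+1], hence 3, and the first exponent is no smaller. *)
Lemma edge_degree_even : (1 < J)%N -> ~~ odd J ->
  exists2 q, P q & (6 <= q.1 + q.2)%N.
Proof.
move=> J1 oJ; have [q [q' [Pq Pq' wq wq' lt]]] := edge_pair.
exists q' => //; have le := top_degree_ge (ltnW J1) Pq' wq'.
have /dvdn_leq : (J.+1 %| q'.2 - q.2)%N.
  apply: (@dvdn_edge_even _ (q.1 - q'.1)); rewrite 1?ltnW //.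
  by move: wq wq'; rewrite /wt; nia.
lia.
Qed.

(** Divisibility gives only [J.+1./2], which is still at least 3 once [5 <= J]. *)
Lemma edge_degree_odd : (5 <= J)%N -> odd J ->
  exists2 q, P q & (6 <= q.1 + q.2)%N.
Proof.
move=> J5 oJ; have [q [q' [Pq Pq' wq wq' lt]]] := edge_pair.
have J0 : (0 < J)%N by lia.
exists q' => //; have le := top_degree_ge J0 Pq' wq'.
have /dvdn_leq : (J.+1./2 %| q'.2 - q.2)%N.
  apply: (@dvdn_edge_odd _ (q.1 - q'.1)) => //.
  by move: wq wq'; rewrite /wt; nia.
lia.
Qed.

(** * The case of top frequency three *)

Section DegreeThree.
Hypothesis J3 : J = 3.
Hypothesis n2 : 2%:R != 0 :> K.
Hypothesis A1 : A`_1 = 0.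
Hypothesis B1 : B`_1 = 0.
Hypothesis A3n0 : A`_3 != 0.
Hypothesis AB3 : A`_3 = B`_3.
Hypothesis AB0 : B`_0 = - 2%:R * A`_0.

(** The coefficient of degree 3. In a top term, that of [A ^+ i * B ^+ k] is the constant
    coefficient times [i A_3 / A_0 + k B_3 / B_0], which is [(2 i - k) A_3 / (2 A_0)]. *)
Lemma edge_sum3_eq0 :
  \sum_(q | P q && (wt q == M)) (2 * q.1%:R - q.2%:R) * term q = 0.
Proof.
have eM : ~~ odd M by rewrite /M /wt J3 oddD !oddM.
have B0' : 2 * A`_0 != 0 by rewrite mulf_neq0.
have := congr1 (fun p : {poly K} => 2 * A`_0 / A`_3 * p`_3) edge_poly_eq0.
rewrite coef0 mulr0 coef_sum (bigID (fun q => wt q == M)) /= [X in _ + X]big1.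
  rewrite addr0 mulr_sumr => e; rewrite -[RHS]e {e}.
  apply: eq_bigr => q /andP[_ /eqP ->].
  rewrite subnn expr0 mulr1 coefZ coef3M0 ?coef1X0 //.
  rewrite !coef0X /term; have /= := coef3X0 q.1 A1; have /= := coef3X0 q.2 B1.
  rewrite -AB3 AB0; set a3 := (A ^+ _)`_3; set b3 := (B ^+ _)`_3 => eb ea.
  have {ea}-> : a3 = (q.1%:R * A`_3 * A`_0 ^+ q.1) / A`_0.
    by rewrite -ea mulrAC mulfV // mul1r.
  have {eb}-> : b3 = (q.2%:R * A`_3 * (- 2%:R * A`_0) ^+ q.2) / (- 2 * A`_0).
    by rewrite -eb mulrAC mulfV ?mul1r // mulNr oppr_eq0.
  by field; rewrite A3n0 A0 oppr_eq0 n2.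
(* Weights are even for [J = 3], so a lower monomial is shifted by 2 or by more than 3; a shift by 2
   exposes a coefficient of degree 1, which is zero. *)
move=> q /andP[Pq wq]; rewrite coefZ coefMXn.
have wM := maxM Pq; have ew : ~~ odd (wt q) by rewrite /wt J3 oddD !oddM.
case: ltnP => [|l3]; first by rewrite mulr0.
have -> : (3 - (M - wt q) = 1)%N.
  by move: (M) (wt q) wM ew wq eM l3; clear; lia.
by rewrite coef1M0 ?mulr0 ?coef1X0.
Qed.

Lemma edge_degree_three : exists2 q, P q & (6 <= q.1 + q.2)%N.
Proof.
have [qa [qb [Pqa Pqb wqa wqb lt]]] := edge_pair.
have [/existsP[q /andP[Pq l6]]|] :=
  boolP [exists q : I, P q && (6 <= q.1 + q.2)%N]; first by exists q.
rewrite negb_exists => /forallP no.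
have gap (q q' : I) : P q -> P q' -> wt q = M -> wt q' = M ->
    (q.2 < q'.2)%N -> (q'.2 = q.2 + 2 :> nat)%N /\ (q.1 = q'.1 + 1 :> nat)%N.
  move=> Pq Pq' wq wq' l; have J0 : (0 < J)%N by rewrite J3.
  have le := top_degree_ge J0 Pq' wq'.
  have := no q'; rewrite Pq' /= -ltnNge; apply: edge_gap_three l le.
  by have := wq; rewrite -wq' /wt J3.
have [e2 e1] := gap _ _ Pqa Pqb wqa wqb lt.
have nqab : qb != qa by apply: contraTneq lt => ->; rewrite ltnn.
have s0 := edge_sum_eq0; have s3 := edge_sum3_eq0.
(* A third top monomial would have a second exponent at distance 2 from both of two numbers that
   themselves differ by 2. *)
have other q : P q && (wt q == M) && (q != qa) && (q != qb) = false.
  apply/negP => /andP[/andP[/andP[Pq /eqP wq] na] nb].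
  have ne (q' : I) : wt q' = M -> q != q' -> q.2 != q'.2 :> nat.
    move=> wq'; apply: contraNneq => e; apply/eqP; apply: injective_projections.
      apply: val_inj; move/eqP: wq'.
      by rewrite -wq /wt e eqn_add2r eqn_pmul2l // => /eqP.
    exact: val_inj.
  have := ne _ wqa na; have := ne _ wqb nb; rewrite !neq_ltn.
  have ga := gap q qa; have ga' := gap qa q; have gb := gap q qb.
  have gb' := gap qb q; move=> /orP[l|l] /orP[l'|l'].
  - have [x _] := ga Pq Pqa wq wqa l'; have [y _] := gb Pq Pqb wq wqb l.
    by move: x y e2; clear; lia.
  - have [x _] := ga' Pqa Pq wqa wq l'; have [y _] := gb Pq Pqb wq wqb l.
    by move: x y e2; clear; lia.
  - have [x _] := ga Pq Pqa wq wqa l'; have [y _] := gb' Pqb Pq wqb wq l.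
    by move: x y e2; clear; lia.
  - have [x _] := ga' Pqa Pq wqa wq l'; have [y _] := gb' Pqb Pq wqb wq l.
    by move: x y e2; clear; lia.
have split2 (F : I -> K) :
    \sum_(q | P q && (wt q == M)) F q = F qa + F qb.
  rewrite (bigD1 qa) /=; last by rewrite Pqa wqa eqxx.
  rewrite (bigD1 qb) /=; last by rewrite Pqb wqb eqxx nqab.
  by rewrite (eq_bigl _ _ other) big_pred0_eq addr0.
move: s0 s3; rewrite !split2 => s0.
have -> : term qb = - term qa by apply/eqP; rewrite -addr_eq0 addrC s0.
rewrite e2 e1 !natrD => s3.
(* The factors [2 i - k] of the two terms differ by 4, while the terms are opposite. *)
have : 2 * 2 * term qa = 0 by rewrite -s3; ring.
move/eqP; rewrite /term !mulf_eq0 !expf_eq0 (negbTE A0) (negbTE B0) (negbTE n2).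
by rewrite !andbF !orbF /= (negbTE (Pqa : h _ _ != 0)).
Qed.

End DegreeThree.
End NewtonEdge.

(** * Prime ideals of plane polynomials *)

Lemma ex_min_nat (Q : nat -> Prop) :
  (exists n, Q n) -> exists n, Q n /\ forall m, Q m -> (n <= m)%N.
Proof.
move=> [n]; elim/ltn_ind: n => n ih Qn.
have [[m [mn Qm]]|no] := classic (exists m, (m < n)%N /\ Q m); first exact: ih Qm.
exists n; split=> // m Qm; rewrite leqNgt; apply/negP => mn.
by apply: no; exists m.
Qed.

Lemma ex_min_size (T : Type) (Q : T -> Prop) (sz : T -> nat) :
  (exists x, Q x) -> exists x, Q x /\ forall y, Q y -> (sz x <= sz y)%N.
Proof.
move=> [x Qx]; have [|n [[y [Qy <-]] ymin]] :=
  @ex_min_nat (fun n => exists y, Q y /\ sz y = n); first by exists (sz x), x.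
by exists y; split=> // z Qz; apply: ymin; exists z.
Qed.

Section PlanePrime.
Variable F : fieldType.
Implicit Types (P : {poly {poly F}}) (x y : F).

Lemma horner2_spec P x y :
  P.[y%:P].[x] = (map_poly (horner_eval x) P).[y].
Proof.
by rewrite -[LHS]/(horner_eval x P.[_]) -horner_map /= /horner_eval hornerC.
Qed.

Lemma spec_eq0_factor P x : map_poly (horner_eval x) P = 0 ->
  exists Q, P = ('X - x%:P) *: Q.
Proof.
move=> P0; exists (map_poly (fun r => r %/ ('X - x%:P)) P); apply/polyP => i.
rewrite coefZ coef_map_id0 ?div0p // mulrC divpK //.
rewrite dvdp_XsubCl; apply/rootP.
by have := congr1 (fun p : {poly F} => p`_i) P0; rewrite coef_map coef0.
Qed.

(** If [c] is nonzero at [x], evaluation suffices. Otherwise ['X - x%:P] divides [c], so [q * f]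
    specializes to zero at [x], and hence so does [q]; the common factor cancels and the size of [c]
    drops. *)
Lemma cancel_scale c g q f x y : c != 0 -> c *: g = q * f ->
  map_poly (horner_eval x) f != 0 -> f.[y%:P].[x] = 0 -> g.[y%:P].[x] = 0.
Proof.
move=> c0 e fx f0; have [n] := ubnP (size c).
elim: n c g q c0 e => // n ih c g q c0 e sc.
have [cx|cx] := eqVneq c.[x] 0; last first.
  have := congr1 (fun p : {poly {poly F}} => p.[y%:P].[x]) e.
  rewrite hornerZ !hornerM f0 mulr0 => /eqP.
  by rewrite mulf_eq0 (negbTE cx) /= => /eqP.
have /factor_theorem[c' ec] : root c x by apply/rootP.
have c'0 : c' != 0 by apply: contraNneq c0 => c'0; rewrite ec c'0 mul0r.
have [|q' eq'] := @spec_eq0_factor q x.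
  have := congr1 (map_poly (horner_eval x)) e; rewrite rmorphM /=.
  have -> : map_poly (horner_eval x) (c *: g) = 0.
    apply/polyP => i; rewrite coef_map coefZ coef0 /= /horner_eval hornerM cx.
    by rewrite mul0r.
  by move/esym/eqP; rewrite mulf_eq0 (negbTE fx) orbF => /eqP.
apply: (ih c' g q') => //.
  have X0 : ('X - x%:P)%:P != 0 :> {poly {poly F}}.
    by rewrite polyC_eq0 polyXsubC_eq0.
  apply: (mulfI X0); rewrite [RHS]mulrA [X in _ = X * _]mul_polyC -eq' -e ec.
  by rewrite -!mul_polyC mulrA polyCM [_%:P * _]mulrC.
move: sc; rewrite ec size_Mmonic ?monicXsubC // size_XsubC addn2; lia.
Qed.

Variable V : {poly {poly F}} -> Prop.
Hypothesis VB : forall P Q, V P -> V Q -> V (P - Q).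
Hypothesis VM : forall P Q, V Q -> V (P * Q).
Hypothesis Vprime : forall P Q, V (P * Q) -> V P \/ V Q.
Hypothesis VX : forall x, ~ V ('X - x%:P)%:P.
Hypothesis Vn0 : exists P, P != 0 /\ V P.

(** [f] is shown to divide a member of [V] only up to a power of its leading coefficient, a
    polynomial in x; this is enough to transfer its zeros. *)
Lemma plane_prime_generator : exists f : {poly {poly F}}, [/\ f != 0, V f,
  forall g h : {poly {poly F}}, f = g * h ->
    (exists c, g = c%:P%:P) \/ (exists c, h = c%:P%:P)
  & forall x y, f.[y%:P].[x] = 0 -> forall g, V g -> g.[y%:P].[x] = 0].
Proof.
have [f1 [[f10 Vf1] min1]] := ex_min_size (fun P => size P) Vn0.
have [|f [[f0 Vf sf] min2]] := @ex_min_size _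
  (fun P => [/\ P != 0, V P & size P = size f1]) (fun P => size (lead_coef P)).
  by exists f1.
have minf P : P != 0 -> V P -> (size f <= size P)%N.
  by move=> P0 VP; rewrite sf; apply: min1.
have minl P : P != 0 -> V P -> (size P <= size f)%N ->
    (size (lead_coef f) <= size (lead_coef P))%N.
  by move=> P0 VP l; apply: min2; split=> //; apply/eqP; rewrite -sf eqn_leq l minf.
(* Minimality of the degree in y makes the cofactor free of y, then minimality of the leading
   coefficient makes it constant. *)
have fac (g h : {poly {poly F}}) : f = g * h -> V g -> exists c, h = c%:P%:P.
  move=> e Vg; have : g != 0 /\ h != 0.
    by apply/andP; rewrite -negb_or -mulf_eq0 -e.
  case=> g0 h0; have lg := minf _ g0 Vg.
  have sh : (size h <= 1)%N.
    by move: lg; rewrite e size_mul // -subn1 leq_subLR addnC leq_add2r.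
  have eh := size1_polyC sh.
  have h00 : h`_0 != 0 by apply: contraNneq h0 => h00; rewrite eh h00.
  have ll : (size (lead_coef f) <= size (lead_coef g))%N.
    have sh1 : size h = 1%N by apply/eqP; rewrite eqn_leq sh size_poly_gt0.
    by apply: minl => //; rewrite e size_mul // sh1 addn1.
  have sh0 : (size (h`_0)%R <= 1)%N.
    have lh : lead_coef h = h`_0 by rewrite [in LHS]eh lead_coefC.
    move: ll; rewrite e lead_coefM lh.
    by rewrite size_mul ?lead_coef_eq0 // -subn1 leq_subLR addnC leq_add2r.
  by exists h`_0`_0; rewrite -(size1_polyC sh0).
exists f; split=> //.
  move=> g h e; have [Vg|Vh] : V g \/ V h by apply: Vprime; rewrite -e.
    by right; apply: fac Vg.
  by left; apply: (fac h); rewrite // mulrC.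
move=> x y fxy g Vg.
(* [f] vanishes on no vertical line: otherwise ['X - x%:P] splits off, the cofactor lies in [V] by
   [VX], and [fac] makes ['X - x%:P] constant. *)
have : map_poly (horner_eval x) f != 0.
  apply/eqP => /spec_eq0_factor[Q eQ].
  have eQ' : f = ('X - x%:P)%:P * Q by rewrite mul_polyC.
  have [/VX//|VQ] : V ('X - x%:P)%:P \/ V Q by apply: Vprime; rewrite -eQ'.
  have [c /(congr1 (fun p : {poly {poly F}} => size p`_0))] :
      exists c, ('X - x%:P)%:P = c%:P%:P.
    by apply: (fac Q) => //; rewrite mulrC.
  by rewrite !coefC /= size_XsubC size_polyC; case: (c != 0).
(* Pseudo-division in y: the remainder lies in [V] and is smaller than [f], so it is zero. *)
have := Pdiv.Idomain.divp_eq g f.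
have -> : g %% f = 0.
  apply/eqP; apply: contraT => r0.
  have := minf _ r0; rewrite leqNgt Pdiv.Idomain.ltn_modp f0 => /(_ _) c.
  apply: contraT => _; suff /c : V (g %% f) by [].
  have -> : g %% f = (lead_coef f ^+ scalp g f)%:P * g - (g %/ f) * f.
    by rewrite mul_polyC Pdiv.Idomain.divp_eq addrC addKr.
  by apply: VB; apply: VM.
rewrite addr0 => e fx; apply: (cancel_scale _ e fx fxy).
by rewrite expf_neq0 // lead_coef_eq0.
Qed.

End PlanePrime.

(** * Bivariate polynomials *)

Definition varx : poly2 := 'X_ord0.
Definition vary : poly2 := 'X_ord_max.

Lemma poly2_ind (Q : poly2 -> Prop) :
  (forall c, Q c%:MP) -> Q varx -> Q vary ->
  (forall f g, Q f -> Q g -> Q (f + g)) ->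
  (forall f g, Q f -> Q g -> Q (f * g)) -> forall f, Q f.
Proof.
move=> QC Qx Qy QD QM; have QX f k : Q f -> Q (f ^+ k).
  move=> Qf; elim: k => [|k ih]; first by rewrite expr0 -mpolyC1.
  by rewrite exprS; apply: QM.
elim/mpolyind => [|c m p _ _ Qp]; first by rewrite -mpolyC0.
apply: QD => //; rewrite -mul_mpolyC; apply: (QM) => //.
rewrite mpolyXE_id !big_ord_recl big_ord0 mulr1.
have -> : lift ord0 ord0 = ord_max :> 'I_2 by apply: val_inj.
by apply: QM; apply: QX.
Qed.

Section Ev2.
Implicit Types (f g : poly2) (x y : R).

Lemma ev20 x y : ev2 0 x y = 0. Proof. exact: meval0. Qed.
Lemma ev2C c x y : ev2 c%:MP x y = c. Proof. exact: mevalC. Qed.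
Lemma ev2x x y : ev2 varx x y = x.
Proof. by rewrite /ev2 /varx mevalXU ffunE. Qed.
Lemma ev2y x y : ev2 vary x y = y.
Proof. by rewrite /ev2 /vary mevalXU ffunE. Qed.
Lemma ev2D f g x y : ev2 (f + g) x y = ev2 f x y + ev2 g x y.
Proof. exact: mevalD. Qed.
Lemma ev2N f x y : ev2 (- f) x y = - ev2 f x y.
Proof. exact: mevalN. Qed.
Lemma ev2M f g x y : ev2 (f * g) x y = ev2 f x y * ev2 g x y.
Proof. exact: mevalM. Qed.
Lemma ev2X f k x y : ev2 (f ^+ k) x y = ev2 f x y ^+ k.
Proof. exact: rmorphXn. Qed.

End Ev2.

(** x is the inner indeterminate and y the outer one, so that [size] measures the degree in y. *)
Definition bipoly (f : poly2) : {poly {poly R}} :=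
  mmap (polyC \o polyC) (fun i : 'I_2 => if val i == 0%N then 'X%:P else 'X) f.

Fact comm_varx : commr_rmorph (@mpolyC 2 R) varx.
Proof. by move=> c; apply: mulrC. Qed.

Fact comm_vary : commr_rmorph (horner_morph comm_varx) vary.
Proof. by move=> c; apply: mulrC. Qed.

Definition of_bipoly : {poly {poly R}} -> poly2 := horner_morph comm_vary.

Lemma bipolyC c : bipoly c%:MP = c%:P%:P.
Proof. exact: mmapC. Qed.
Lemma bipolyx : bipoly varx = 'X%:P.
Proof. by rewrite /bipoly mmapX mmap1U. Qed.
Lemma bipolyy : bipoly vary = 'X.
Proof. by rewrite /bipoly mmapX mmap1U. Qed.
Lemma bipolyD f g : bipoly (f + g) = bipoly f + bipoly g.
Proof. exact: mmapD. Qed.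
Lemma bipolyM f g : bipoly (f * g) = bipoly f * bipoly g.
Proof. exact: rmorphM. Qed.

Lemma of_bipolyC c : of_bipoly c%:P%:P = c%:MP.
Proof. by rewrite /of_bipoly horner_morphC /= horner_morphC. Qed.
Lemma of_bipolyx : of_bipoly 'X%:P = varx.
Proof. by rewrite /of_bipoly horner_morphC /= horner_morphX. Qed.
Lemma of_bipolyy : of_bipoly 'X = vary.
Proof. exact: horner_morphX. Qed.
Lemma of_bipolyD P Q : of_bipoly (P + Q) = of_bipoly P + of_bipoly Q.
Proof. exact: rmorphD. Qed.
Lemma of_bipolyM P Q : of_bipoly (P * Q) = of_bipoly P * of_bipoly Q.
Proof. exact: rmorphM. Qed.

Lemma bipolyK : cancel bipoly of_bipoly.
Proof.
elim/poly2_ind=> [c|||f g ef eg|f g ef eg].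
- by rewrite bipolyC of_bipolyC.
- by rewrite bipolyx of_bipolyx.
- by rewrite bipolyy of_bipolyy.
- by rewrite bipolyD of_bipolyD ef eg.
- by rewrite bipolyM of_bipolyM ef eg.
Qed.

Lemma bipoly_horner (f : poly2) x y : (bipoly f).[y%:P].[x] = ev2 f x y.
Proof.
elim/poly2_ind: f => [c|||f g ef eg|f g ef eg].
- by rewrite bipolyC ev2C !hornerC.
- by rewrite bipolyx ev2x !hornerE.
- by rewrite bipolyy ev2y !hornerE.
- by rewrite bipolyD ev2D !hornerD ef eg.
- by rewrite bipolyM ev2M !hornerM ef eg.
Qed.

Lemma of_bipolyK : cancel of_bipoly bipoly.
Proof.
elim/poly_ind => [|P c IH]; first by rewrite /of_bipoly rmorph0 /bipoly raddf0.
rewrite of_bipolyD of_bipolyM of_bipolyy bipolyD bipolyM bipolyy IH; congr (_ + _).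
elim/poly_ind: c => [|p c ih].
  by rewrite /of_bipoly rmorph0 /bipoly raddf0.
rewrite polyCD polyCM of_bipolyD of_bipolyM of_bipolyx of_bipolyC.
by rewrite bipolyD bipolyM bipolyx bipolyC ih.
Qed.

Lemma bipoly_inj : injective bipoly. Proof. exact: can_inj bipolyK. Qed.

Lemma of_bipoly_ev2 P x y : ev2 (of_bipoly P) x y = P.[y%:P].[x].
Proof. by rewrite -bipoly_horner of_bipolyK. Qed.

Lemma poly_neq0_point (p : {poly R}) : p != 0 -> exists x, p.[x] != 0.
Proof.
move=> p0; pose s := [seq k%:R : R | k <- iota 0 (size p)].
have us : uniq s.
  by rewrite map_inj_uniq ?iota_uniq // => i j /eqP; rewrite eqr_nat => /eqP.
have : ~~ all (root p) s.
  apply/negP => rs; have := max_poly_roots p0 rs us.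
  by rewrite size_map size_iota ltnn.
by case/allPn => x _ nx; exists x.
Qed.

Lemma poly2_neq0_point (f : poly2) : f != 0 -> exists x y, ev2 f x y != 0.
Proof.
move=> f0; have P0 : bipoly f != 0.
  apply: contraNneq f0 => e; apply/eqP/bipoly_inj.
  by rewrite e -mpolyC0 bipolyC.
have [x nx] : exists x, (lead_coef (bipoly f)).[x] != 0.
  by apply: poly_neq0_point; rewrite lead_coef_eq0.
have [|y ny] := @poly_neq0_point (map_poly (horner_eval x) (bipoly f)).
  apply: contraNneq nx => e.
  have := congr1 (fun p : {poly R} => p`_(size (bipoly f)).-1) e.
  by rewrite coef_map coef0 => /eqP.
by exists x, y; rewrite -bipoly_horner horner2_spec.
Qed.

(** * The unit circle *)

Lemma complex_ext (a b c d : R) :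
  a = c -> b = d -> Complex a b = Complex c d :> R[i].
Proof. by move=> -> ->. Qed.

(* [vt t = exp (- i t)]: the negative exponent makes the growth of the curve
   at [i oo] visible at the origin *)
Definition vt (t : R) : R[i] := Complex (cos t) (- sin t).
Definition wt (t : R) : R[i] := Complex (cos t) (sin t).

Lemma vt_wt t : vt t * wt t = 1.
Proof.
apply: complex_ext; last by ring.
by have := sin2_cos2 t; rewrite /Rsqr RplusE !RmultE => e; rewrite -[1]e; ring.
Qed.

Lemma vt_neq0 t : vt t != 0.
Proof.
by apply/eqP => e; have /eqP := vt_wt t; rewrite e mul0r eq_sym oner_eq0.
Qed.

Lemma wtE t : wt t = (vt t)^-1.
Proof. by apply: (mulfI (vt_neq0 t)); rewrite vt_wt mulfV // vt_neq0. Qed.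

Lemma vtX t j : vt t ^+ j = Complex (cos (INR j * t)) (- sin (INR j * t)).
Proof.
elim: j => [|j ih].
  by rewrite expr0; apply: complex_ext; rewrite Rmult_0_l ?cos_0 ?sin_0 ?oppr0.
have -> : (INR j.+1 * t = INR j * t + t)%coqR.
  by rewrite S_INR Rmult_plus_distr_r Rmult_1_l.
rewrite exprS ih; apply: complex_ext.
  by rewrite cos_plus RminusE !RmultE; ring.
by rewrite sin_plus RplusE !RmultE; ring.
Qed.

Lemma wtX t j : wt t ^+ j = Complex (cos (INR j * t)) (sin (INR j * t)).
Proof.
have -> : wt t = (vt t)^*%C by apply: complex_ext; rewrite ?opprK.
by rewrite -rmorphXn /= vtX; apply: complex_ext; rewrite ?opprK.
Qed.

Lemma infinite_vt :
  infinite_pred (fun v => exists2 t, (- PI <= t <= PI)%coqR & v = vt t).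
Proof.
(* The angles [k / N] lie in [[0, 1]], within [[0, PI]] where [cos] is injective. *)
move=> N; pose tk (k : nat) : R := (INR k / INR N)%coqR.
exists [seq vt (tk k) | k <- iota 0 N]; split; last 1 first.
- move=> v /mapP[k]; rewrite mem_iota add0n => /andP[_ kN] ->; exists (tk k) => //.
  have h : (0 < INR N)%coqR by apply: lt_0_INR; lia.
  have k0 := pos_INR k; have kN' : (INR k <= INR N)%coqR by apply: le_INR; lia.
  have pi2 := PI2_1.
  have : (0 <= tk k <= 1)%coqR.
    split; first by apply: Rdiv_le_0_compat.
    by apply: (Rmult_le_reg_r (INR N)) => //; rewrite /tk; field_simplify; Lra.lra.
  by Lra.lra.
- rewrite map_inj_in_uniq ?iota_uniq // => i j.
  rewrite !mem_iota !add0n => /andP[_ iN] /andP[_ jN] [e _].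
  have h : (0 < INR N)%coqR by apply: lt_0_INR; lia.
  have pi2 := PI2_1.
  have b (k : nat) : (k < N)%N -> (0 <= tk k <= PI)%coqR.
    move=> kN; have k0 := pos_INR k.
    have kN' : (INR k <= INR N)%coqR by apply: le_INR; lia.
    split; first by apply: Rdiv_le_0_compat.
    apply: (Rle_trans _ 1); last by Lra.lra.
    by apply: (Rmult_le_reg_r (INR N)) => //; rewrite /tk; field_simplify; Lra.lra.
  have := cos_inj _ _ (b i iN) (b j jN) e.
  move=> /(Rmult_eq_reg_r _ _ _) h'; apply: INR_eq; apply: h'.
  by apply: Rinv_neq_0_compat; Lra.lra.
- by rewrite size_map size_iota.
Qed.

(** * Trigonometric curves *)

Lemma is_derive_harmonic (a b k t : R) :
  is_derive (fun u => (a * cos (k * u) + b * sin (k * u))%coqR) t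
    (k * (b * cos (k * t) - a * sin (k * t)))%coqR.
Proof. by auto_derive => //; Lra.lra. Qed.

Section TrigSum.
Variables (J : nat) (al be : nat -> R).

Definition trig_sum (t : R) : R :=
  \sum_(j < J.+1) (al j * cos (INR j * t) + be j * sin (INR j * t)).

Definition trig_sum' (t : R) : R :=
  \sum_(j < J.+1) INR j * (be j * cos (INR j * t) - al j * sin (INR j * t)).

Lemma is_derive_big n (F F' : nat -> R -> R) t :
  (forall j, is_derive (F j) t (F' j t)) ->
  is_derive (fun t => \sum_(j < n) F j t) t (\sum_(j < n) F' j t).
Proof.
move=> dF; elim: n => [|n ih].
  rewrite big_ord0; apply: (@is_derive_ext R_AbsRing R_NormedModule (fun=> 0)).
    by move=> u; rewrite big_ord0.
  exact: (@is_derive_const R_AbsRing R_NormedModule).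
rewrite big_ord_recr /=.
apply: (@is_derive_ext R_AbsRing R_NormedModule
  (fun u => \sum_(j < n) F j u + F n u)).
  by move=> u; rewrite big_ord_recr.
exact: (@is_derive_plus _ _ (fun u => \sum_(j < n) F j u) (F n)).
Qed.

Lemma Derive_trig_sum t : Derive trig_sum t = trig_sum' t.
Proof.
apply: is_derive_unique; rewrite /trig_sum /trig_sum'.
pose F (j : nat) (u : R) := al j * cos (INR j * u) + be j * sin (INR j * u).
pose F' (j : nat) (u : R) :=
  INR j * (be j * cos (INR j * u) - al j * sin (INR j * u)).
apply: (@is_derive_big J.+1 F F') => j.
exact: is_derive_harmonic.
Qed.

Definition pos_x t := trig_sum t * cos t - trig_sum' t * sin t.
Definition pos_y t := trig_sum t * sin t + trig_sum' t * cos t.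

(** [half_coef 1 j] and [half_coef' 1 j] are the coefficients of [wt t ^+ j] and [vt t ^+ j] in the
    harmonic of frequency [j]. Differentiation multiplies them by [i j] and [- i j], whence the
    factors [1 - s * j] and [1 + s * j] in [zpoly]. *)
Definition half_coef (s : R) (j : nat) : R[i] :=
  Complex (s * al j / 2) (- (s * be j / 2)).
Definition half_coef' (s : R) (j : nat) : R[i] :=
  Complex (s * al j / 2) (s * be j / 2).

(* [zpoly 1] and [zpoly (-1)] are [vt t ^+ J] times [p + i p'] and [p - i p'],
   written as polynomials in [vt t] *)
Definition zpoly (s : R) : {poly R[i]} :=
  \sum_(j < J.+1) (half_coef (1 - s * j%:R)%R j *: 'X^(J - j)
                 + half_coef' (1 + s * j%:R)%R j *: 'X^(J + j)).

Lemma complex_sum n (f g : nat -> R) :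
  Complex (\sum_(j < n) f j) (\sum_(j < n) g j)
  = \sum_(j < n) Complex (f j) (g j) :> R[i].
Proof.
elim: n => [|n ih]; first by rewrite !big_ord0.
by rewrite !big_ord_recr -ih.
Qed.

Lemma vtX_sub t j : (j <= J)%N -> vt t ^+ (J - j) = vt t ^+ J * wt t ^+ j.
Proof.
move=> jJ; rewrite -[in RHS](subnK jJ) exprD -mulrA -exprMn_comm ?vt_wt.
  by rewrite expr1n mulr1.
exact: mulrC.
Qed.

Lemma zpolyE s t :
  (zpoly s).[vt t] = vt t ^+ J * Complex (trig_sum t) (s * trig_sum' t).
Proof.
rewrite horner_sum mulr_sumr (complex_sum _
  (fun j => al j * cos (INR j * t) + be j * sin (INR j * t))
  (fun j => s * (INR j * (be j * cos (INR j * t) - al j * sin (INR j * t))))).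
rewrite mulr_sumr; apply: eq_bigr => -[j /= jJ] _.
rewrite hornerD !hornerZ !hornerXn vtX_sub // exprD.
rewrite [vt t ^+ j]vtX wtX; set v := vt t ^+ J.
rewrite !mulrA ![_ * v]mulrC -!mulrA -mulrDr; congr (v * _).
by apply: complex_ext; rewrite ?INRE; field.
Qed.

(** [x + i y = (p + i p') exp (i t)]; the conjugate carries [exp (- i t)] instead, hence its
    denominator of exponent [J.-1]. *)
Lemma pos_z t :
  (zpoly 1%R).[vt t] / vt t ^+ J.+1 = Complex (pos_x t) (pos_y t).
Proof.
rewrite zpolyE; set P := Complex _ _; have v0 := vt_neq0 t.
have -> : vt t ^+ J * P / vt t ^+ J.+1 = P * wt t.
  by rewrite wtE exprS; field; rewrite expf_neq0 ?v0.
by apply: complex_ext; rewrite /pos_x /pos_y; ring.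
Qed.

Lemma pos_zb t : (0 < J)%N ->
  (zpoly (-1)%R).[vt t] / vt t ^+ J.-1 = Complex (pos_x t) (- pos_y t).
Proof.
move=> J0; rewrite zpolyE -{1}(prednK J0) exprS mulrAC.
rewrite mulfK ?expf_neq0 ?vt_neq0 //.
by apply: complex_ext; rewrite /pos_x /pos_y; ring.
Qed.

Lemma zpoly_coef s k : (zpoly s)`_k = \sum_(j < J.+1)
  (half_coef (1 - s * j%:R)%R j * (k == J - j)%N%:R
   + half_coef' (1 + s * j%:R)%R j * (k == J + j)%N%:R).
Proof.
by rewrite coef_sum; apply: eq_bigr => j _; rewrite coefD !coefZ !coefXn.
Qed.

(** Only the harmonic [J] reaches degree 0; the factor is [1 - J] for the point and [1 + J] for its
    conjugate. *)
Lemma zpoly_coef0 s :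
  (0 < J)%N -> (zpoly s)`_0 = half_coef (1 - s * J%:R)%R J.
Proof.
move=> J0; rewrite zpoly_coef big_ord_recr big1 /= => [|[j jJ] _ /=].
  have -> : (0 == J + J)%N = false by lia.
  by rewrite subnn eqxx mulr1 add0r mulr0 addr0.
have -> : (0 == J - j)%N = false by lia.
have -> : (0 == J + j)%N = false by lia.
by rewrite !mulr0 addr0.
Qed.

Lemma size_zpoly s : (size (zpoly s) <= J.*2.+1)%N.
Proof.
apply: (leq_trans (size_sum _ _ _)); apply/bigmax_leqP => -[j jJ] _ /=.
apply: (leq_trans (size_polyD _ _)); rewrite geq_max; apply/andP.
by split; apply: (leq_trans (size_scale_leq _ _)); rewrite size_polyXn; lia.
Qed.

Lemma half_coef_eq0 s j : s != 0 ->
  (half_coef s j == 0) = (al j == 0) && (be j == 0).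
Proof.
move=> s0; rewrite eq_complex /= oppr_eq0 !mulf_eq0 invr_eq0.
by rewrite (negbTE s0) pnatr_eq0 /= !orbF.
Qed.

End TrigSum.

(** * The lower bound *)

Section TotalDegree.
Variable K : comNzRingType.
Implicit Types P Q : {poly {poly K}}.

Definition tdeg_le (D : nat) P := forall i k, (D < i + k)%N -> P`_i`_k = 0.

Lemma tdeg_leD D P Q : tdeg_le D P -> tdeg_le D Q -> tdeg_le D (P + Q).
Proof. by move=> p q i k h; rewrite !coefD p ?q // addr0. Qed.

Lemma tdeg_leM D1 D2 P Q :
  tdeg_le D1 P -> tdeg_le D2 Q -> tdeg_le (D1 + D2) (P * Q).
Proof.
move=> p q i k h; rewrite coefM coef_sum big1 // => -[j /= ji] _.
rewrite coefM big1 // => -[l /= lk] _.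
have [d|d] := ltnP D1 (j + l); first by rewrite p ?mul0r.
by rewrite q ?mulr0 //; lia.
Qed.

Lemma tdeg_leW D1 D2 P : (D1 <= D2)%N -> tdeg_le D1 P -> tdeg_le D2 P.
Proof. by move=> h p i k d; apply: p; lia. Qed.

Lemma tdeg_leC c : tdeg_le 0 c%:P%:P.
Proof. by move=> [|i] [|k] // _; rewrite !coefC //= ?coefC ?coef0. Qed.

Lemma tdeg_leX D P k : tdeg_le D P -> tdeg_le (D * k) (P ^+ k).
Proof.
move=> p; elim: k => [|k ih]; first by rewrite expr0 muln0; apply: tdeg_leC.
by rewrite exprS mulnS; apply: tdeg_leM.
Qed.

Lemma tdeg_le_inner : tdeg_le 1 'X%:P.
Proof.
move=> [|i] k h; rewrite coefC /= ?coef0 // coefX.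
by have -> : (k == 1)%N = false by lia.
Qed.

Lemma tdeg_le_outer : tdeg_le 1 'X.
Proof.
move=> i k h; rewrite coefX; case: eqP => [e|_]; last by rewrite coef0.
by rewrite coef1; have -> : (k == 0)%N = false by lia.
Qed.

Lemma tdeg_le_horner D P x y : tdeg_le D P ->
  P.[y%:P].[x] = \sum_(q : 'I_D.+1 * 'I_D.+1) P`_q.2`_q.1 * x ^+ q.1 * y ^+ q.2.
Proof.
move=> p; rewrite -(pair_bigA _ (fun i k : 'I_D.+1 => P`_k`_i * x ^+ i * y ^+ k)).
rewrite exchange_big /=.
have sP : (size P <= D.+1)%N.
  apply/leq_sizeP => i Di; apply/polyP => k; rewrite coef0.
  by apply: p; lia.
rewrite (horner_coef_wide _ sP) horner_sum; apply: eq_bigr => i _.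
rewrite hornerM -polyC_exp hornerC.
have si : (size (P`_i)%R <= D.+1)%N.
  by apply/leq_sizeP => k Dk; apply: p; lia.
by rewrite (horner_coef_wide _ si) mulr_suml.
Qed.

End TotalDegree.

(** The linear substitution [x = (z + zb) / 2], [y = i (zb - z) / 2] does not raise the total
    degree; [z] is the inner indeterminate of [U] and [V], [zb] the outer one. *)
Lemma zzb_expansion (f : poly2) : exists h : nat -> nat -> R[i],
  (forall i k, (tdeg f < i + k)%N -> h i k = 0) /\
  forall x y, (ev2 f x y)%:C%C =
    \sum_(q : 'I_(tdeg f).+1 * 'I_(tdeg f).+1)
      h q.1 q.2 * Complex x y ^+ q.1 * Complex x (- y) ^+ q.2.
Proof.
pose U : {poly {poly R[i]}} := (Complex (1 / 2) 0)%:P%:P * ('X%:P + 'X).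
pose V : {poly {poly R[i]}} := (Complex 0 (1 / 2))%:P%:P * ('X - 'X%:P).
pose F : {rmorphism R -> {poly {poly R[i]}}} := polyC \o (polyC \o real_complex R).
pose H (i : 'I_2) := if val i == 0%N then U else V.
pose P := mmap F H f.
have tU : tdeg_le 1 U.
  apply: (@tdeg_leM _ 0 1); first exact: tdeg_leC.
  by apply: tdeg_leD; [apply: tdeg_le_inner | apply: tdeg_le_outer].
have tV : tdeg_le 1 V.
  apply: (@tdeg_leM _ 0 1); first exact: tdeg_leC.
  apply: tdeg_leD; first exact: tdeg_le_outer.
  by move=> i k d; rewrite !coefN tdeg_le_inner // oppr0.
have tP : tdeg_le (tdeg f) P.
  rewrite /P /mmap big_seq; elim/big_ind: _ => [i k _|p q|m mf].
  - by rewrite !coef0.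
  - exact: tdeg_leD.
  have md : (mdeg m <= tdeg f)%N.
    by rewrite /tdeg -ltnS (ltn_predK (msize_mdeg_lt mf)) msize_mdeg_lt.
  apply: tdeg_leW md _; rewrite -[mdeg m]add0n; apply: tdeg_leM.
    exact: tdeg_leC.
  rewrite /mmap1 mdegE !big_ord_recl !big_ord0 mulr1 addn0.
  by apply: tdeg_leM; rewrite -[X in tdeg_le X]mul1n; apply: tdeg_leX.
have eP x y : P.[(Complex x (- y))%:P].[Complex x y] = (ev2 f x y)%:C%C.
  rewrite /P; elim/poly2_ind: {tP P} f => [c|||g h eg eh|g h eg eh].
  - by rewrite mmapC /= !hornerC ev2C.
  - rewrite /varx mmapX mmap1U /H /= ev2x /U !hornerE.
    by apply: complex_ext; rewrite /=; field.
  - rewrite /vary mmapX mmap1U /H /= ev2y /V !hornerE.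
    by apply: complex_ext; rewrite /=; field.
  - by rewrite mmapD !hornerD eg eh ev2D rmorphD.
  - by rewrite rmorphM !hornerM eg eh ev2M rmorphM.
exists (fun i k => P`_k`_i); split=> [i k d|x y]; first by apply: tP; lia.
by rewrite -eP (tdeg_le_horner _ _ tP).
Qed.

Lemma zzb_expansion_sym (f : poly2) : f != 0 -> exists h : nat -> nat -> R[i],
  [/\ forall i k, (tdeg f < i + k)%N -> h i k = 0,
      forall i k, h i k != 0 -> h k i != 0,
      exists q : 'I_(tdeg f).+1 * 'I_(tdeg f).+1, h q.1 q.2 != 0
   &  forall x y, ev2 f x y = 0 ->
    \sum_(q : 'I_(tdeg f).+1 * 'I_(tdeg f).+1)
      h q.1 q.2 * Complex x y ^+ q.1 * Complex x (- y) ^+ q.2 = 0].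
Proof.
move=> f0; have [h [hD hE]] := zzb_expansion f.
(* Adding the conjugate transpose expands twice [f], since [f] is real, and makes the symmetry hold
   without uniqueness of the expansion. *)
pose g i k := h i k + conjc (h k i).
have gE x y : \sum_(q : 'I_(tdeg f).+1 * 'I_(tdeg f).+1)
      g q.1 q.2 * Complex x y ^+ q.1 * Complex x (- y) ^+ q.2
    = (ev2 f x y)%:C%C *+ 2.
  rewrite mulr2n -{2}conjc_real hE rmorph_sum /=.
  under eq_bigr do rewrite /g !mulrDl.
  rewrite big_split /=; congr (_ + _).
  rewrite -(pair_bigA _ (fun i k : 'I_(tdeg f).+1 =>
    conjc (h k i) * Complex x y ^+ i * Complex x (- y) ^+ k)).
  rewrite exchange_big pair_bigA /=; apply: eq_bigr => q _.
  by rewrite !rmorphM !rmorphXn /= opprK mulrAC.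
exists g; split=> [i k d|i k||x y e].
- by rewrite /g !hD ?conjc0 ?addr0 // addnC.
- apply: contraNneq => e.
  have gC : conjc (g i k) = g k i by rewrite /g rmorphD /= conjcK addrC.
  by rewrite -conjc_eq0 gC e.
- have [x [y nz]] := poly2_neq0_point f0.
  apply/existsP; apply: contraNT nz => /existsPn no.
  have := gE x y; rewrite big1 => [/esym/eqP|q _].
    rewrite mulrn_eq0 /= eq_complex /= => /andP[]//.
  by have := no q; rewrite negbK => /eqP ->; rewrite !mul0r.
- by rewrite gE e mul0rn.
Qed.

Lemma trig_curve_degree_ge6 J al be (f : poly2) :
  (2 <= J)%N -> (al J != 0) || (be J != 0) ->
  (J = 3 -> [/\ al 2 = 0, be 2 = 0 & al 0%N != 0]) ->
  f != 0 ->
  (forall t, (- PI <= t <= PI)%coqR ->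
     ev2 f (pos_x J al be t) (pos_y J al be t) = 0) ->
  (6 <= tdeg f)%N.
Proof.
move=> J2 top h3 f0 van.
have [h [hD hsym [q hq] hE]] := zzb_expansion_sym f0.
pose A := zpoly J al be 1%R; pose B := zpoly J al be (-1)%R.
pose S v := exists2 t, (- PI <= t <= PI)%coqR & v = vt t.
have S0 v : S v -> v != 0 by case=> t _ ->; apply: vt_neq0.
have J0 : (0 < J)%N by lia.
have hS v : S v -> \sum_(q : 'I_(tdeg f).+1 * 'I_(tdeg f).+1)
    h q.1 q.2 * (A.[v] / v ^+ J.+1) ^+ q.1 * (B.[v] / v ^+ J.-1) ^+ q.2 = 0.
  by case=> t tpi ->; rewrite pos_z pos_zb // hE // van.
have A0 : A`_0 != 0.
  rewrite zpoly_coef0 // half_coef_eq0 ?negb_and //.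
  by rewrite mul1r subr_eq0 eq_sym pnatr_eq1; lia.
have B0 : B`_0 != 0.
  rewrite zpoly_coef0 // half_coef_eq0 ?negb_and //.
  by rewrite mulN1r opprK nat1r pnatr_eq0.
suff [q' hq' le] : exists2 q : 'I_(tdeg f).+1 * 'I_(tdeg f).+1,
    h q.1 q.2 != 0 & (6 <= q.1 + q.2)%N.
  apply: leq_trans le _; rewrite leqNgt; apply: contra hq' => d.
  by rewrite hD.
have sym (p : 'I_(tdeg f).+1 * 'I_(tdeg f).+1) :
  h p.1 p.2 != 0 -> h (p.2, p.1).1 (p.2, p.1).2 != 0 by apply: hsym.
have [oJ|eJ] := boolP (odd J); last first.
  exact: (edge_degree_even infinite_vt S0 hS sym hq A0 B0).
have [J5|J5] := leqP 5 J.
  exact: (edge_degree_odd infinite_vt S0 hS sym hq A0 B0).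
have J3 : J = 3 by lia.
have [a2 b2 a0] := h3 J3.
(* For [J = 3], frequency 2 alone feeds the coefficient of degree 1, and frequency 0 alone that of
   degree 3. *)
have hc0 s : half_coef al be s 2 = 0.
  by apply: complex_ext; rewrite ?a2 ?b2 mulr0 mul0r ?oppr0.
have h1 : half_coef al be 1%R 0 + half_coef' al be 1%R 0 = (al 0%N)%:C%C.
  by apply: complex_ext; field.
have A3 : A`_3 = (al 0%N)%:C%C.
  rewrite /A zpoly_coef J3 !big_ord_recl big_ord0 /= /bump /=.
  by rewrite !(mulr0, mulr1, addr0) subr0.
have B3 : B`_3 = (al 0%N)%:C%C.
  rewrite /B zpoly_coef J3 !big_ord_recl big_ord0 /= /bump /=.
  by rewrite !(mulr0, mulr1, addr0) subr0.
apply: (edge_degree_three infinite_vt S0 hS sym hq A0 B0 J3).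
- by rewrite pnatr_eq0.
- rewrite /A zpoly_coef J3 !big_ord_recl big_ord0 /= /bump /=.
  by rewrite !(mulr0, mulr1, addr0, add0r) hc0.
- rewrite /B zpoly_coef J3 !big_ord_recl big_ord0 /= /bump /=.
  by rewrite !(mulr0, mulr1, addr0, add0r) hc0.
- by rewrite A3 eq_complex /= negb_and a0.
- by rewrite A3 B3.
(* The constant coefficients are [-2 c] and [4 c] with [c = half_coef al be 1 3]. *)
rewrite /A /B !zpoly_coef0 // J3.
rewrite -[2%:R](rmorph_nat (real_complex R)) -rmorphN.
by apply: complex_ext; rewrite /=; field.
Qed.

(** * Curves of the class *)

Definition single (j0 : nat) (c : R) (j : nat) : R := if j == j0 then c else 0.

Lemma trig_sum_single J j0 A B t : (j0 <= J)%N ->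
  trig_sum J (single j0 A) (single j0 B) t
  = A * cos (INR j0 * t) + B * sin (INR j0 * t).
Proof.
move=> jJ; rewrite /trig_sum (bigD1 (Ordinal (jJ : (j0 < J.+1)%N))) //= big1.
  by rewrite /single eqxx addr0.
move=> [j jlt] /=; rewrite -val_eqE /single /= => /negbTE ->.
by rewrite !mul0r addr0.
Qed.

Lemma trig_sumD J al be al' be' t :
  trig_sum J (fun j => al j + al' j) (fun j => be j + be' j) t
  = trig_sum J al be t + trig_sum J al' be' t.
Proof. by rewrite /trig_sum -big_split; apply: eq_bigr => j _ /=; ring. Qed.

Lemma trig_sum_widen J N al be t : (J <= N)%N ->
  (forall j, (J < j <= N)%N -> al j = 0 /\ be j = 0) ->
  trig_sum N al be t = trig_sum J al be t.
Proof.
elim: N => [|N ih]; first by rewrite leqn0 => /eqP -> _.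
rewrite leq_eqVlt => /orP[/eqP ->|JN] z //.
rewrite /trig_sum big_ord_recr /=.
have JN1 : (J < N.+1 <= N.+1)%N by lia.
have [-> ->] := z _ JN1; rewrite !mul0r !addr0; apply: ih => [|j jN]; first by lia.
by apply: z; lia.
Qed.

(** Each [k >= 1] adds the frequencies [k n + 1] and [k n - 1]; [n >= 3] keeps both away from 0, so
    the mean remains [rho]. *)
Lemma supp_fun_trig n m rho a b : (3 <= n)%N -> exists al be,
  [/\ forall t, supp_fun n m rho a b t = trig_sum (m * n).+1 al be t,
      forall j, ((m * n).+1 < j)%N -> al j = 0 /\ be j = 0,
      al 0%N = rho
   &  forall j, (2 <= j)%N -> (al j != 0) || (be j != 0) ->
        exists k, j = (k * n).+1 \/ j.+1 = (k * n)%N].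
Proof.
move=> n3; elim: m => [|m [al [be [e z r s]]]].
  (* At [k = 0] the indices 1 and -1 both have frequency 1: cosine coefficients add and sine
     coefficients subtract. *)
  exists (fun j => single 0 rho j + single 1 (a 1%coqZ + a (-1)%coqZ) j).
  exists (fun j => single 0 0 j + single 1 (b 1%coqZ - b (-1)%coqZ) j).
  split.
  - move=> t; rewrite trig_sumD !trig_sum_single // /supp_fun /=.
    rewrite Rmult_0_l Rmult_1_l cos_0 sin_0.
    have -> : (-1 * t)%coqR = (- t)%coqR by Lra.lra.
    by rewrite cos_neg sin_neg -!RplusE -!RmultE; Lra.lra.
  - by move=> [|[|j]] //; rewrite /single /= addr0.
  - by rewrite /single /= addr0.
  - by move=> [|[|j]] // _; rewrite /single /= addr0 eqxx.
set j1 := (m.+1 * n).+1; set j2 := (m.+1 * n).-1.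
have j1z : Z.add (Z.of_nat (m.+1 * n)) 1 = Z.of_nat j1 by rewrite /j1; lia.
have j2z : Z.sub (Z.of_nat (m.+1 * n)) 1 = Z.of_nat j2 by rewrite /j2; nia.
exists (fun j => al j + (single j1 (a (Z.of_nat j1)) j
                         + single j2 (a (Z.of_nat j2)) j)).
exists (fun j => be j + (single j1 (b (Z.of_nat j1)) j
                         + single j2 (b (Z.of_nat j2)) j)).
split.
- move=> t; rewrite !trig_sumD !trig_sum_single //; last by rewrite /j2; lia.
  rewrite (@trig_sum_widen (m * n).+1) => [||j jj]; first last.
  + by apply: z; lia.
  + by rewrite ltnS leq_mul2r leqnSn orbT.
  rewrite -e /supp_fun /= -/(muln _ _) -/(m.+1 * n)%N j1z j2z -!INR_IZR_INZ.
  by rewrite !(RplusE, RmultE); ring.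
- move=> j jj; have [|-> ->] := z j.
    by apply: leq_ltn_trans jj; rewrite ltnS leq_mul2r leqnSn orbT.
  rewrite /single.
  have -> : (j == j1) = false by rewrite /j1; lia.
  have -> : (j == j2) = false by rewrite /j2; lia.
  by rewrite !addr0.
- rewrite /single; have -> : (0%N == j1) = false by [].
  have -> : (0%N == j2) = false by rewrite /j2; nia.
  by rewrite !addr0.
move=> j j2'; rewrite /single.
have [->|_] := eqVneq j j1; first by move=> _; exists m.+1; left.
have [->|_] := eqVneq j j2.
  by move=> _; exists m.+1; right; rewrite /j2 prednK // muln_gt0; lia.
by rewrite !addr0; apply: s.
Qed.

Lemma unit_circle_angle (c s : R) : (c * c + s * s = 1)%coqR ->
  exists2 t, (- PI <= t <= PI)%coqR & c = cos t /\ s = sin t.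
Proof.
move=> e; have c1 : (-1 <= c <= 1)%coqR by split; Lra.nra.
have [b0 b1] := acos_bound c; have ca := cos_acos c c1.
have sa := sin_acos c c1; have -> : c = cos (acos c) by rewrite ca.
have e2 : (1 - c² = s * s)%coqR by rewrite /Rsqr; Lra.lra.
rewrite e2 in sa; have [s0|s0] := Rle_dec 0 s.
  exists (acos c); first by Lra.lra.
  by rewrite sa sqrt_square.
exists (- acos c)%coqR; first by Lra.lra.
rewrite cos_neg sin_neg sa; split=> //.
have -> : (s * s = (- s) * (- s))%coqR by Lra.lra.
by rewrite sqrt_square; Lra.lra.
Qed.

Definition traced_by J al be (C : R -> R -> Prop) := forall x y, C x y <->
  exists2 t, (- PI <= t <= PI)%coqR & x = pos_x J al be t /\ y = pos_y J al be t.

(** Frequency 1 in a support function only translates the curve, here to the centre [(al 1, be 1)];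
    frequency 0 is the radius. *)
Lemma trig_sum_circle al be C : (0 < al 0%N)%coqR -> traced_by 1 al be C ->
  is_circle C.
Proof.
move=> r0 tr; exists (al 1%N), (be 1%N), (al 0%N); split=> // x y.
have E t : pos_x 1 al be t = (al 0%N * cos t + al 1%N)%coqR
        /\ pos_y 1 al be t = (al 0%N * sin t + be 1%N)%coqR.
  rewrite /pos_x /pos_y /trig_sum /trig_sum' !big_ord_recl !big_ord0 /= /bump /=.
  rewrite Rmult_0_l !Rmult_1_l cos_0 sin_0.
  have := sin2_cos2 t; rewrite /Rsqr => e.
  rewrite !addr0 !addn0 -!RminusE -!RplusE -!RmultE.
  set c := cos t in e *; set s := sin t in e *.
  split.
    have -> : (al 0%N * c + al 1%N = al 0%N * c + al 1%N * (s * s + c * c))%coqR.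
      by rewrite e; Lra.lra.
    by Lra.lra.
  have -> : (al 0%N * s + be 1%N = al 0%N * s + be 1%N * (s * s + c * c))%coqR.
    by rewrite e; Lra.lra.
  by Lra.lra.
rewrite tr; split=> [[t _ [-> ->]]|e].
  have [-> ->] := E t; have := sin2_cos2 t; rewrite /Rsqr => e; Lra.nra.
have [|t tpi [ec es]] := @unit_circle_angle ((x - al 1%N) / al 0%N)%coqR
  ((y - be 1%N) / al 0%N)%coqR.
  apply: (Rmult_eq_reg_r (al 0%N * al 0%N)%coqR); last by Lra.nra.
  by field_simplify; Lra.nra.
exists t => //; have [-> ->] := E t; rewrite -ec -es.
have simp u : (al 0%N * (u / al 0%N) = u)%coqR.
  by rewrite /Rdiv -Rmult_assoc Rinv_r_simpl_m //; Lra.lra.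
by rewrite !simp; split; Lra.lra.
Qed.

(** [J] is the highest frequency from 2 on that occurs; if there is none, the curve is a circle. *)
Lemma class_trig_curve C : in_class_R C -> ~ is_circle C -> exists J al be,
  [/\ (2 <= J)%N, (al J != 0) || (be J != 0),
      J = 3 -> [/\ al 2 = 0, be 2 = 0 & al 0%N != 0] & traced_by J al be C].
Proof.
move=> [n [m [rho [a [b [n3 [r0 [_ CE]]]]]]]] nc.
have [al [be [e z r s]]] := supp_fun_trig m rho a b n3.
have tr N : (forall j, (N < j <= (m * n).+1)%N -> al j = 0 /\ be j = 0) ->
    (N <= (m * n).+1)%N -> traced_by N al be C.
  move=> zN NN x y; rewrite CE /curve_of.
  have eN t : supp_fun n m rho a b t = trig_sum N al be t.
    by rewrite e; apply: trig_sum_widen.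
  have dN t : Derive (supp_fun n m rho a b) t = trig_sum' N al be t.
    by rewrite (Derive_ext _ _ _ eN) Derive_trig_sum.
  split=> [[t [tpi [-> ->]]]|[t tpi [-> ->]]]; exists t => //.
    by rewrite eN dN.
  by rewrite eN dN.
pose Q j := (2 <= j <= (m * n).+1)%N && ((al j != 0) || (be j != 0)).
have [/existsP[j0 Qj0]|] := boolP [exists j : 'I_(m * n).+2, Q j]; last first.
  move=> /existsPn no; case: nc.
  apply: (@trig_sum_circle al be); first by rewrite r.
  apply: tr => // j /andP[j1 jm].
  have := no (Ordinal (jm : (j < (m * n).+2)%N)); rewrite /Q /= j1 jm /=.
  by rewrite negb_or !negbK => /andP[/eqP -> /eqP ->].
have [|J QJ Jmax] := @ex_maxnP Q (m * n).+1 (ex_intro _ (val j0) Qj0).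
  by move=> j /andP[/andP[]].
move: QJ => /andP[/andP[J2 Jm] nz]; exists J, al, be; split=> //; last first.
  apply: tr => // j /andP[Jj jm].
  have : ~~ Q j by apply/negP => /Jmax; lia.
  rewrite /Q jm andbT negb_and negb_or !negbK.
  by case/orP => [|/andP[/eqP -> /eqP ->]//]; lia.
(* [J = 3] requires [k n = 2] or [k n = 4], so [n = 4]; frequency 2 would then require [4 k = 1] or
   [4 k = 3]. *)
move=> J3; have [k kJ] := s J J2 nz.
have {}kJ : n = 4 by move: kJ n3; rewrite J3; case: k => [|[|k]]; nia.
have : ~~ ((al 2 != 0) || (be 2 != 0)).
  by apply/negP => /(s 2 isT)[k2]; rewrite kJ; lia.
rewrite negb_or !negbK => /andP[/eqP -> /eqP ->]; split=> //.
by rewrite r; apply/eqP => rz; move: r0; rewrite rz => /Rlt_irrefl.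
Qed.

(** * Laurent parametrizations *)

Lemma linear_dependence (K : fieldType) (I : finType) (Q : I -> {poly K}) N :
  (N < #|I|)%N -> (forall i, (size (Q i) <= N)%N) ->
  exists c : I -> K, (exists i, c i != 0) /\ \sum_i c i *: Q i = 0.
Proof.
move=> NI sQ; pose M : 'M[K]_(#|I|, N) := \matrix_(r, k) (Q (enum_val r))`_k.
have kM : kermx M != 0.
  rewrite kermx_eq0 /row_free; apply: contraTneq NI => <-.
  by rewrite -leqNgt rank_leq_col.
pose v := nz_row (kermx M).
have vM : v *m M = 0 by apply/sub_kermxP; apply: nz_row_sub.
have v0 : v != 0 by rewrite nz_row_eq0.
exists (fun i => v 0 (enum_rank i)); split.
  apply/existsP; apply: contraNT v0 => /existsPn no.
  apply/eqP/rowP => r; rewrite mxE; apply/eqP.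
  by have := no (enum_val r); rewrite negbK enum_valK.
apply/polyP => k; rewrite coef0 coef_sum.
have [kN|kN] := ltnP k N; last first.
  rewrite big1 // => i _; rewrite coefZ nth_default ?mulr0 //.
  exact: leq_trans (sQ i) kN.
have := congr1 (fun A : 'rV_N => A 0 (Ordinal kN)) vM; rewrite !mxE => e.
rewrite -[RHS]e (reindex (@enum_val I predT)) /=; last first.
  by exists enum_rank => i _; rewrite ?enum_valK ?enum_rankK.
by apply: eq_bigr => r _; rewrite coefZ !mxE enum_valK.
Qed.

Section Laurent.
Variables (J : nat) (al be : nat -> R).
Hypothesis J0 : (0 < J)%N.
Let px := pos_x J al be.
Let py := pos_y J al be.

(** Numerators of x and y over [v ^+ J.+1]; the factor ['X^2] brings the conjugate, whose
    denominator is [v ^+ J.-1], to that denominator. *)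
Definition xpoly : {poly R[i]} :=
  (Complex (1 / 2) 0) *: (zpoly J al be 1%R + 'X^2 * zpoly J al be (-1)%R).
Definition ypoly : {poly R[i]} :=
  (Complex 0 (1 / 2)) *: ('X^2 * zpoly J al be (-1)%R - zpoly J al be 1%R).

Lemma zpoly_vt t :
  (zpoly J al be 1%R).[vt t] = vt t ^+ J.+1 * Complex (px t) (py t).
Proof. by rewrite -pos_z mulrCA divff ?mulr1 // expf_neq0 // vt_neq0. Qed.

Lemma zbpoly_vt t :
  ('X^2 * zpoly J al be (-1)%R).[vt t] = vt t ^+ J.+1 * Complex (px t) (- py t).
Proof.
rewrite hornerM hornerXn -pos_zb // -{2}(prednK J0) !exprS expr0 mulr1.
by field; rewrite expf_neq0 ?vt_neq0.
Qed.

Lemma xpolyE t : xpoly.[vt t] = vt t ^+ J.+1 * (px t)%:C%C.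
Proof.
rewrite hornerZ hornerD zpoly_vt zbpoly_vt -mulrDr mulrCA; congr (_ * _).
by apply: complex_ext; field.
Qed.

Lemma ypolyE t : ypoly.[vt t] = vt t ^+ J.+1 * (py t)%:C%C.
Proof.
rewrite hornerZ hornerD hornerN zpoly_vt zbpoly_vt -mulrBr mulrCA; congr (_ * _).
by apply: complex_ext; field.
Qed.

Lemma size_X2zpoly : (size ('X^2 * zpoly J al be (-1)%R)%R <= (J.+1 * 2).+1)%N.
Proof.
apply: (leq_trans (size_polyMleq _ _)); rewrite size_polyXn.
by have := size_zpoly J al be (-1)%R; lia.
Qed.

Lemma size_xpoly : (size xpoly <= (J.+1 * 2).+1)%N.
Proof.
apply: (leq_trans (size_scale_leq _ _)); apply: (leq_trans (size_polyD _ _)).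
rewrite geq_max size_X2zpoly andbT; apply: (leq_trans (size_zpoly _ _ _ _)); lia.
Qed.

Lemma size_ypoly : (size ypoly <= (J.+1 * 2).+1)%N.
Proof.
apply: (leq_trans (size_scale_leq _ _)); apply: (leq_trans (size_polyD _ _)).
rewrite geq_max size_X2zpoly size_polyN /=.
apply: (leq_trans (size_zpoly _ _ _ _)); lia.
Qed.

Definition laurent (F : R -> R[i]) :=
  exists e (P : {poly R[i]}), forall t, P.[vt t] = vt t ^+ e * F t.

Lemma laurent_ev2 (f : poly2) : laurent (fun t => (ev2 f (px t) (py t))%:C%C).
Proof.
elim/poly2_ind: f => [c|||f g [e [P hP]] [e' [Q hQ]]|f g [e [P hP]] [e' [Q hQ]]].
- by exists 0%N, (c%:C%C)%:P => t; rewrite hornerC ev2C expr0 mul1r.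
- by exists J.+1, xpoly => t; rewrite xpolyE ev2x.
- by exists J.+1, ypoly => t; rewrite ypolyE ev2y.
- exists (e + e')%N, ('X^e' * P + 'X^e * Q) => t.
  by rewrite hornerD !hornerM !hornerXn hP hQ ev2D rmorphD /= exprD; ring.
- exists (e + e')%N, (P * Q) => t.
  by rewrite hornerM hP hQ ev2M rmorphM /= exprD; ring.
Qed.

Lemma laurent_poly_eq0 (P : {poly R[i]}) :
  (forall t, (- PI <= t <= PI)%coqR -> P.[vt t] = 0) -> P = 0.
Proof.
by move=> h; apply: (infinite_roots_eq0 infinite_vt) => v [t tp ->]; apply: h.
Qed.

Definition vanishes (f : poly2) :=
  forall t, (- PI <= t <= PI)%coqR -> ev2 f (px t) (py t) = 0.

(** The numerators of [f] and [g] along the curve are polynomials whose product has infinitely many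
    roots, so one of them is zero. *)
Lemma vanishes_prime f g : vanishes (f * g) -> vanishes f \/ vanishes g.
Proof.
move=> fg; have [e [P hP]] := laurent_ev2 f; have [e' [Q hQ]] := laurent_ev2 g.
have : P * Q = 0.
  apply: laurent_poly_eq0 => t /fg; rewrite ev2M hornerM hP hQ => h.
  by rewrite mulrACA -rmorphM /= h mulr0.
have zero h c (S : {poly R[i]}) :
    (forall t, S.[vt t] = vt t ^+ c * (ev2 h (px t) (py t))%:C%C) ->
    S = 0 -> vanishes h.
  move=> hS S0 t _; have /esym/eqP := hS t; rewrite S0 horner0 mulf_eq0.
  by rewrite expf_eq0 (negbTE (vt_neq0 t)) andbF /= eq_complex /= => /andP[/eqP].
by move/eqP; rewrite mulf_eq0 => /orP[/eqP|/eqP] z;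
  [left; apply: zero hP z | right; apply: zero hQ z].
Qed.

Lemma exists_vanishing : exists P : {poly {poly R}},
  P != 0 /\ vanishes (of_bipoly P).
Proof.
(* The [D.+1 ^ 2] products of powers up to [D] share the denominator [v ^+ (2 D J.+1)], with
   numerators of size at most [4 J.+1 D + 1], which is [D ^ 2 + 1] for this [D]. *)
pose D := (4 * J.+1)%N.
pose Q (q : 'I_D.+1 * 'I_D.+1) : {poly R[i]} :=
  xpoly ^+ q.1 * ypoly ^+ q.2 * 'X^(J.+1 * (D.*2 - q.1 - q.2)).
have sX (p : {poly R[i]}) k : (size p <= (J.+1 * 2).+1)%N ->
    (size (p ^+ k)%R <= (J.+1 * 2 * k).+1)%N.
  move=> sp; apply: (leq_trans (size_poly_exp_leq _ _)).
  by rewrite ltnS leq_mul2r; lia.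
have [||c [[q cq] s0]] := @linear_dependence _ _ Q (4 * J.+1 * D).+1.
- by rewrite card_prod !card_ord /D; nia.
- move=> [[i iD] [k kD]]; rewrite /Q /=.
  apply: (leq_trans (size_polyMleq _ _)); rewrite size_polyXn.
  have s1 := size_polyMleq (xpoly ^+ i) (ypoly ^+ k).
  have s2 := sX _ i size_xpoly; have s3 := sX _ k size_ypoly.
  have : (size (xpoly ^+ i * ypoly ^+ k)%R <= (J.+1 * 2 * (i + k)).+1)%N.
    by apply: (leq_trans s1); rewrite mulnDr; lia.
  move: (size _) => s s4; have : (i + k <= D.*2)%N by lia.
  by rewrite addnS /= -subnDA; move: s4; clear; nia.
have cE t : \sum_q c q * ((px t) ^+ q.1 * (py t) ^+ q.2)%:C%C = 0.
  have v0 : vt t ^+ (J.+1 * D.*2) != 0 by rewrite expf_neq0 // vt_neq0.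
  apply: (mulfI v0); rewrite mulr0 mulr_sumr.
  have := congr1 (fun p : {poly R[i]} => p.[vt t]) s0.
  rewrite horner0 horner_sum => e; rewrite -[RHS]e.
  apply: eq_bigr => -[[i iD] [k kD]] _ /=.
  rewrite hornerZ !hornerM !horner_exp hornerX xpolyE ypolyE !exprMn -!exprM.
  rewrite rmorphM !rmorphXn /=.
  have -> : (J.+1 * D.*2 = J.+1 * i + J.+1 * k + J.+1 * (D.*2 - i - k))%N.
    by rewrite -!mulnDr; congr (_ * _)%N; lia.
  by rewrite !exprD; ring.
(* x and y are real on the curve, so the real and imaginary parts of the coefficients satisfy the
   relation too; one of them is nonzero at [q]. *)
pose mk (part : R[i] -> R) : {poly {poly R}} :=
  \poly_(k < D.+1) \poly_(i < D.+1) part (c (inord i, inord k)).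
have mkE part : (forall x y, part (x + y) = part x + part y) ->
    (forall x (r : R), part (x * r%:C%C) = part x * r) -> part 0 = 0 ->
    vanishes (of_bipoly (mk part)).
  move=> pD pM p0 t _; rewrite of_bipoly_ev2 horner_poly horner_sum.
  have := congr1 part (cE t); rewrite p0 (big_morph part pD p0) => e.
  rewrite -[RHS]e.
  pose G (i k : 'I_D.+1) := part (c (i, k) * ((px t) ^+ i * (py t) ^+ k)%:C%C).
  rewrite [RHS](eq_bigr (fun q => G q.1 q.2)) => [|[i k] _ //].
  rewrite -(pair_bigA _ G) exchange_big; apply: eq_bigr => k _ /=.
  rewrite hornerM -polyC_exp hornerC horner_poly mulr_suml.
  by apply: eq_bigr => i _; rewrite /G !inord_val pM mulrA.
have mk0 part : part (c q) != 0 -> mk part != 0.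
  apply: contraNneq => e; have := congr1 (fun p : {poly {poly R}} => p`_q.2`_q.1) e.
  rewrite !coef_poly !ltn_ord /= !coef_poly !ltn_ord !inord_val.
  by rewrite -surjective_pairing !coef0 => /eqP.
have [r0|i0] : complex.Re (c q) != 0 \/ complex.Im (c q) != 0.
- by apply/orP; move: cq; rewrite eq_complex negb_and.
- exists (mk (@complex.Re R)); split; first exact: mk0.
  apply: mkE => //; first by case=> ? ? [].
  by case=> a b r /=; rewrite mulr0 subr0.
- exists (mk (@complex.Im R)); split; first exact: mk0.
  apply: mkE => //; first by case=> ? ? [].
  by case=> a b r /=; rewrite mulr0 add0r.
Qed.

End Laurent.

(** * The defining polynomial *)

Definition vanishes_on (C : R -> R -> Prop) (f : poly2) :=
  forall x y, C x y -> ev2 f x y = 0.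

Lemma vanishes_traced J al be C f : traced_by J al be C ->
  vanishes_on C f <-> vanishes J al be f.
Proof.
move=> tr; split=> [h t tp|h x y /tr[t tp [-> ->]]]; last exact: h.
by apply: h; apply/tr; exists t.
Qed.

Section NonCircle.
Variable C : R -> R -> Prop.
Hypotheses (CR : in_class_R C) (Cn : ~ is_circle C).

Lemma vanishing_degree_ge6 f : f != 0 -> vanishes_on C f -> (6 <= tdeg f)%N.
Proof.
move=> f0 van; have [J [al [be [J2 nz J3 tr]]]] := class_trig_curve CR Cn.
by apply: (trig_curve_degree_ge6 J2 nz J3 f0); apply/(vanishes_traced f tr).
Qed.

Lemma vanishing_prime f g :
  vanishes_on C (f * g) -> vanishes_on C f \/ vanishes_on C g.
Proof.
move=> van; have [J [al [be [J2 _ _ tr]]]] := class_trig_curve CR Cn.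
rewrite !(vanishes_traced _ tr); apply: vanishes_prime; first by lia.
exact/(vanishes_traced _ tr).
Qed.

Lemma vanishing_nonzero : exists P, P != 0 /\ vanishes_on C (of_bipoly P).
Proof.
have [J [al [be [J2 _ _ tr]]]] := class_trig_curve CR Cn.
have [|P [P0 vP]] := @exists_vanishing J al be; first by lia.
by exists P; split=> //; apply/(vanishes_traced _ tr).
Qed.

Lemma exists_defining_poly : exists f, defining_poly f C.
Proof.
have [||||f [f0 Vf fac zero]] := plane_prime_generator
  (V := fun P => vanishes_on C (of_bipoly P)) _ _ _ _ vanishing_nonzero.
- move=> P Q vP vQ x y Cxy; rewrite of_bipoly_ev2 !hornerE -!of_bipoly_ev2.
  by rewrite vP // vQ // subr0.
- by move=> P Q vQ x y Cxy; rewrite of_bipolyM ev2M vQ // mulr0.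
- by move=> P Q; rewrite of_bipolyM; apply: vanishing_prime.
(* A vertical line in the ideal would have degree at most 1, against the bound 6. *)
- move=> x van.
  have e : of_bipoly ('X - x%:P)%:P = varx - x%:MP.
    by rewrite polyCB /of_bipoly rmorphB /= -/of_bipoly of_bipolyx of_bipolyC.
  have : (6 <= tdeg (varx - x%:MP)%R)%N.
    apply: vanishing_degree_ge6; last by rewrite -e.
    apply/eqP => z; have := ev2D varx (- x%:MP) (x + 1) 0.
    rewrite z ev20 ev2N ev2C ev2x => /eqP.
    by rewrite addrC addKr eq_sym oner_eq0.
  have := msizeD_le varx (- x%:MP); rewrite msizeN /tdeg.
  have : (msize (x%:MP_[2])%R <= 1)%N by rewrite msizeC; case: (x != 0).
  have : msize varx = 2%N by rewrite /varx msizeX mdeg1.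
  move=> -> l1 l2 l3; have := leq_trans l3 (leq_trans (leq_pred _) l2).
  by rewrite leq_max /= => l4; have := leq_trans l4 l1.
have F0 : of_bipoly f != 0.
  apply: contraNneq f0 => z; rewrite -(of_bipolyK f) z -mpolyC0 bipolyC.
  by rewrite !polyC0.
exists (of_bipoly f); split; first split.
- have := vanishing_degree_ge6 F0 Vf; rewrite /tdeg.
  by move=> h; apply: (leq_trans _ (leq_trans h (leq_pred _))).
- move=> g h e; have e' : f = bipoly g * bipoly h.
    by rewrite -bipolyM -e of_bipolyK.
  have const k c : bipoly k = c%:P%:P -> (msize k <= 1)%N.
    move=> ek; have -> : k = c%:MP by apply: bipoly_inj; rewrite ek bipolyC.
    by rewrite msizeC; case: (c != 0).
  by have [[c ec]|[c ec]] := fac _ _ e'; [left|right]; apply: const ec.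
move=> x y; split=> [fxy g vg|]; last by apply.
rewrite -bipoly_horner; apply: zero; first by rewrite -of_bipoly_ev2.
by move=> u v; rewrite bipolyK; apply: vg.
Qed.

Lemma defining_poly_degree_ge6 f : defining_poly f C -> (6 <= tdeg f)%N.
Proof.
move=> [[f1 _] fC]; apply: vanishing_degree_ge6.
  by apply: contraTneq f1 => ->; rewrite msize0.
by move=> x y Cxy; apply/fC => g; apply.
Qed.

End NonCircle.

(** * A curve of degree six *)

(** For [n = 3] the index 2 arises as [k n - 1] with [k = 1]. *)
Definition ex_a (z : Z) : R := if Z.eqb z 2 then (1 / 2)%coqR else 0%coqR.
Definition ex_b (_ : Z) : R := 0%coqR.
Definition ex_supp := supp_fun 3 1 (3 / 2)%coqR ex_a ex_b.
Definition ex_curve := curve_of ex_supp.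

Lemma ex_suppE t : ex_supp t = (3 / 2 + 1 / 2 * cos (2 * t))%coqR.
Proof.
rewrite /ex_supp /supp_fun /= /ex_a /ex_b /=.
by Lra.lra.
Qed.

Lemma Derive_ex_supp t : Derive ex_supp t = (- sin (2 * t))%coqR.
Proof.
rewrite (Derive_ext _ _ _ ex_suppE); apply: is_derive_unique.
by auto_derive => //; Lra.lra.
Qed.

(** Here [p + p'' = 3/2 (1 - cos 2t)]. *)
Lemma ex_supp_convex t : (0 <= ex_supp t + Derive_n ex_supp 2 t)%coqR.
Proof.
rewrite /= (Derive_ext _ _ _ Derive_ex_supp) ex_suppE.
have -> : Derive (fun x => - sin (2 * x))%coqR t = (- 2 * cos (2 * t))%coqR.
  by apply: is_derive_unique; auto_derive => //; Lra.lra.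
by have := COS_bound (2 * t); Lra.lra.
Qed.

Lemma ex_curve_param t :
  (ex_supp t * cos t - Derive ex_supp t * sin t
   = 3 * cos t - cos t * cos t * cos t)%coqR /\
  (ex_supp t * sin t + Derive ex_supp t * cos t = sin t * sin t * sin t)%coqR.
Proof.
rewrite Derive_ex_supp ex_suppE cos_2a sin_2a.
have := sin2_cos2 t; rewrite /Rsqr.
set c := cos t; set s := sin t => e.
have e1 : (s * s * c = c - c * c * c)%coqR.
  have -> : (s * s = 1 - c * c)%coqR by Lra.lra.
  by Lra.lra.
have e2 : (c * c * s = s - s * s * s)%coqR.
  have -> : (c * c = 1 - s * s)%coqR by Lra.lra.
  by Lra.lra.
by split; Lra.lra.
Qed.

Lemma ex_curveE x y : ex_curve x y <-> exists2 t, (- PI <= t <= PI)%coqR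
  & x = (3 * cos t - cos t * cos t * cos t)%coqR
    /\ y = (sin t * sin t * sin t)%coqR.
Proof.
split=> [[t [tp [-> ->]]]|[t tp [-> ->]]].
  by have [-> ->] := ex_curve_param t; exists t.
by have [<- <-] := ex_curve_param t; exists t.
Qed.

Lemma ex_curve_in_class : in_class_R ex_curve.
Proof.
exists 3, 1%N, (3 / 2)%coqR, ex_a, ex_b; split=> //; split; first by Lra.lra.
by split; first exact: ex_supp_convex.
Qed.

Lemma ex_curve_not_circle : ~ is_circle ex_curve.
Proof.
move=> [x0 [y0 [r [r0 h]]]]; have pi0 := PI_RGT_0.
(* A circle through [(2, 0)], [(-2, 0)], [(0, 1)] and [(0, -1)] would be centred at the origin with
   radius both 2 and 1. *)
have p1 : ex_curve 2%coqR 0%coqR.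
  by apply/ex_curveE; exists 0%coqR; [Lra.lra | rewrite cos_0 sin_0; Lra.lra].
have p2 : ex_curve (-2)%coqR 0%coqR.
  by apply/ex_curveE; exists PI; [Lra.lra | rewrite cos_PI sin_PI; Lra.lra].
have p3 : ex_curve 0%coqR 1%coqR.
  apply/ex_curveE; exists (PI / 2)%coqR; first by Lra.lra.
  by rewrite cos_PI2 sin_PI2; Lra.lra.
have p4 : ex_curve 0%coqR (-1)%coqR.
  apply/ex_curveE; exists (- (PI / 2))%coqR; first by Lra.lra.
  by rewrite cos_neg sin_neg cos_PI2 sin_PI2; Lra.lra.
move/h: p1; move/h: p2; move/h: p3; move/h: p4; Lra.nra.
Qed.

(* eliminates [u = sin^2 t] from [x^2 + y^2 - 4 = - 3 u^2] and [y^2 = u^3] *)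
Definition ex_poly : poly2 :=
  (varx ^+ 2 + vary ^+ 2 - 4%:R%:MP) ^+ 3 + 27%:R%:MP * vary ^+ 4.

Lemma ex_polyE x y : ev2 ex_poly x y =
  ((x * x + y * y - 4) * (x * x + y * y - 4) * (x * x + y * y - 4)
   + 27 * (y * y * y * y))%coqR.
Proof.
rewrite /ex_poly !(ev2D, ev2X, ev2M, ev2N, ev2C, ev2x, ev2y).
rewrite !exprS !expr0 !mulr1 -!INRE -!RmultE -!RoppE -!RplusE /=.
by Lra.lra.
Qed.

Lemma cube_root (y : R) : exists s, (y = s * s * s)%coqR.
Proof.
have pos z : (0 < z)%coqR -> exists s, (z = s * s * s)%coqR.
  move=> z0; exists (Rpower z (/ 3)).
  have <- : (Rpower z (/ 3) ^ 3
      = Rpower z (/ 3) * Rpower z (/ 3) * Rpower z (/ 3))%coqR.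
    by rewrite /=; Lra.lra.
  rewrite -Rpower_pow; last exact: exp_pos.
  rewrite Rpower_mult; have -> : (/ 3 * INR 3 = 1)%coqR by rewrite /=; Lra.lra.
  by rewrite Rpower_1.
have [y0|[->|y0]] := Rtotal_order y 0.
- have [|s es] := pos (- y)%coqR; first by Lra.lra.
  by exists (- s)%coqR; Lra.lra.
- by exists 0%coqR; Lra.lra.
- by apply: pos; Lra.lra.
Qed.

Lemma ex_poly_zero x y : ev2 ex_poly x y = 0 <-> ex_curve x y.
Proof.
rewrite ex_polyE ex_curveE; split=> [|[t _ [-> ->]]]; last first.
  have := sin2_cos2 t; rewrite /Rsqr; set c := cos t; set s := sin t => e.
  set X := (3 * c - c * c * c)%coqR; set Y := (s * s * s)%coqR.
  have -> : (X * X + Y * Y - 4 = - 3 * (s * s * s * s))%coqR.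
    rewrite /X /Y.
    have -> : ((3 * c - c * c * c) * (3 * c - c * c * c)
      = (c * c) * ((3 - c * c) * (3 - c * c)))%coqR by Lra.lra.
    have -> : (c * c = 1 - s * s)%coqR by Lra.lra.
    by Lra.lra.
  by rewrite /Y -R0E; Lra.lra.
have [s ->] := cube_root y.
set Y := (s * s * s)%coqR; pose u := (s * s)%coqR.
move=> e; have u0 : (0 <= u)%coqR by rewrite /u; Lra.nra.
(* With [w = 3 u^2] the equation reads [d^3 + w^3 = 0]; the quadratic factor vanishes only at
   [d = w = 0], so [d = - w] in both cases. *)
have e1 : (x * x + Y * Y - 4 = - 3 * (u * u))%coqR.
  pose d := (x * x + Y * Y - 4)%coqR; pose w := (3 * (u * u))%coqR.
  have ed : (d * d * d + w * w * w = 0)%coqR.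
    by rewrite -[RHS]e /d /w /u /Y; Lra.lra.
  have f : ((d + w) * (d * d - d * w + w * w) = 0)%coqR by Lra.lra.
  have [dw|z] := Rmult_integral _ _ f.
    by move: dw; rewrite -/d /w; Lra.lra.
  have q1 := Rle_0_sqr (w - d / 2); have q2 := Rle_0_sqr (d - w / 2).
  have q3 := Rle_0_sqr d; have q4 := Rle_0_sqr w; rewrite /Rsqr in q1 q2 q3 q4.
  have d0 : d = 0%coqR by apply: Rsqr_0_uniq; rewrite /Rsqr; Lra.lra.
  have w0 : w = 0%coqR by apply: Rsqr_0_uniq; rewrite /Rsqr; Lra.lra.
  by rewrite -/d d0; rewrite /w in w0; Lra.lra.
have YY : (Y * Y = u * u * u)%coqR by rewrite /Y /u; Lra.lra.
have xx : (x * x = (1 - u) * ((2 + u) * (2 + u)))%coqR by Lra.lra.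
have u1 : (u <= 1)%coqR by Lra.nra.
(* The parametrization has [x = cos t (3 - cos^2 t) = (2 + u) cos t] with [u = sin^2 t], which
   dictates the cosine. *)
have [|t tp [ec es]] := @unit_circle_angle (x / (2 + u))%coqR s.
  have -> : (x / (2 + u) * (x / (2 + u)) = (x * x) / ((2 + u) * (2 + u)))%coqR.
    by rewrite /Rdiv Rinv_mult; Lra.lra.
  rewrite xx /Rdiv Rmult_assoc Rinv_r; last by Lra.nra.
  by rewrite /u; Lra.lra.
exists t => //; rewrite -ec -es; split=> //.
have cc : (x / (2 + u) * (x / (2 + u)) = 1 - u)%coqR.
  by rewrite ec /u es; have := sin2_cos2 t; rewrite /Rsqr; Lra.lra.
rewrite cc; have -> : (3 * (x / (2 + u)) - (1 - u) * (x / (2 + u))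
    = (2 + u) * x * / (2 + u))%coqR.
  by rewrite /Rdiv; Lra.lra.
by rewrite Rinv_r_simpl_m; Lra.lra.
Qed.

(** The lower bound is the general one, as [ex_poly] vanishes on the curve; only the upper bound is
    computed. *)
Lemma ex_poly_tdeg : tdeg ex_poly = 6%N.
Proof.
have van : vanishes_on ex_curve ex_poly by move=> x y /ex_poly_zero.
have nz : ex_poly != 0.
  apply/eqP => z; have : ev2 ex_poly 3 0 = 0%coqR by rewrite z ev20.
  by rewrite ex_polyE; Lra.lra.
apply/eqP; rewrite eqn_leq.
rewrite (vanishing_degree_ge6 ex_curve_in_class ex_curve_not_circle nz van) andbT.
rewrite /tdeg -ltnS prednK; last by rewrite lt0n msize_poly_eq0.
have mM (f g : poly2) d e : (msize f <= d.+1)%N -> (msize g <= e)%N ->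
    (msize (f * g)%R <= d + e)%N.
  have [->|f0] := eqVneq f 0; first by rewrite mul0r msize0.
  have [->|g0] := eqVneq g 0; first by rewrite mulr0 msize0.
  rewrite msizeM // -subn1 leq_subLR add1n -addSn; exact: leq_add.
have mX (f : poly2) k d : (msize f <= d.+1)%N -> (msize (f ^+ k)%R <= (d * k).+1)%N.
  move=> fd; elim: k => [|k ih]; first by rewrite expr0 msize1.
  by rewrite exprS mulnS -addnS; apply: mM.
have mx : (msize varx <= 2)%N by rewrite /varx msizeX mdeg1.
have my : (msize vary <= 2)%N by rewrite /vary msizeX mdeg1.
have mC c : (msize (c%:MP_[2] : poly2) <= 1)%N by rewrite msizeC; case: (c != 0).
have mD (f g : poly2) d :
    (msize f <= d)%N -> (msize g <= d)%N -> (msize (f + g)%R <= d)%N.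
  by move=> fd gd; apply: (leq_trans (msizeD_le _ _)); rewrite geq_max fd.
rewrite /ex_poly; apply: (mD).
  apply: (mX _ 3 2); apply: (mD); last by rewrite msizeN (leq_trans (mC _)).
  by apply: (mD); [apply: (mX _ 2 1) | apply: (mX _ 2 1)].
apply: (@mM _ _ 0 7); first exact: mC.
exact: leq_trans (mX _ 4 1%N my) _.
Qed.

(** By primality one factor vanishes on the curve and has degree at least 6, which leaves degree 0
    for the other. The curve is the whole zero set, hence Zariski closed. *)
Lemma ex_poly_defining : defining_poly ex_poly ex_curve.
Proof.
have van : vanishes_on ex_curve ex_poly by move=> x y /ex_poly_zero.
have nz : ex_poly != 0.
  by apply/eqP => z; have := ex_poly_tdeg; rewrite z /tdeg msize0.
have mF : msize ex_poly = 7%N.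
  have := ex_poly_tdeg; rewrite /tdeg => e.
  by rewrite -(prednK (n := msize ex_poly)) ?e // lt0n msize_poly_eq0.
split; first split; first by rewrite mF.
  have half (g h : poly2) :
      ex_poly = g * h -> vanishes_on ex_curve g -> (msize h <= 1)%N.
    move=> e vg; have : (g != 0) && (h != 0) by rewrite -negb_or -mulf_eq0 -e.
    move=> /andP[g0 h0].
    have := vanishing_degree_ge6 ex_curve_in_class ex_curve_not_circle g0 vg.
    move: mF; rewrite e msizeM // /tdeg; move: (msize g) (msize h) => u v; lia.
  move=> g h e; have : vanishes_on ex_curve (g * h) by rewrite -e.
  move=> /(vanishing_prime ex_curve_in_class ex_curve_not_circle)[vg|vh].
    by right; apply: half vg.
  by left; apply: (half h); rewrite // mulrC.
move=> x y; split=> [/ex_poly_zero Cxy g vg|]; first exact: vg.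
exact.
Qed.

Theorem theorem2p10 :
  (exists C : R -> R -> Prop, in_class_R C /\ ~ is_circle C /\
     exists f : poly2, defining_poly f C /\ tdeg f = 6%N) /\
  (forall C : R -> R -> Prop, in_class_R C -> ~ is_circle C ->
     (exists f : poly2, defining_poly f C) /\
     forall f : poly2, defining_poly f C -> (6 <= tdeg f)%N).
Proof.
split.
  exists ex_curve; split; first exact: ex_curve_in_class.
  split; first exact: ex_curve_not_circle.
  by exists ex_poly; split; [exact: ex_poly_defining | exact: ex_poly_tdeg].
move=> C CR Cn; split; first exact: exists_defining_poly.
exact: defining_poly_degree_ge6.
Qed.
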